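(* Suppose $\Delta$ is a compact convex quadrilateral in $\mathbb R^2$ which does not have a pair of parallel facets. Then there exists a $2$-parameter family of labels ${\bf L}_{t_1,t_2}$ of $\Delta$ such that $(\Delta,{\bf L}_{t_1,t_2})$ admits an orthotoric Kähler metric $\omega$ which verifies the Abreu–Guillemin boundary conditions with respect to ${\bf L}_{t_1,t_2}$ and satisfies $$\tfrac12dd^cR_\omega\wedge\omega=\theta\wedge\theta+\rho_\omega\wedge\rho_\omega,\qquad R_\omega>0,$$ for some closed $\omega$-primitive $(1,1)$-form $\theta$. For two different values of $t_1/t_2$, the solution satisfies this equation with $\theta=0$.
   Context: $R_\omega,\rho_\omega$ denote the scalar curvature and Ricci form; $d^c=JdJ^{-1}$. A label ${\bf L}=\{L_1,\dots,L_4\}$ of $\Delta$ is a choice of affine-linear functions with $\Delta=\{\mu : L_j(\mu)\ge0,\ j=1,\dots,4\}$, one for each facet (so each $L_j$ is determined up to a positive real factor); no rationality is required. Toric metrics and boundary conditions: a $\mathbb T^2$-invariant $\omega$-compatible Kähler metric on $\mathring\Delta\times\mathbb T^2$ with momentum map the projection to $\mathring\Delta$ is encoded by the symmetric positive definite matrix function $\mathbf H$ on $\mathring\Delta$ of inner products of the fundamental Killing vector fields. The Abreu–Guillemin boundary conditions with respect to $\bf L$ are: $\mathbf H$ extends smoothly to $\Delta$; on the facet $\{L_j=0\}$, $\mathbf H(dL_j,\cdot)=0$ and $d\big(\mathbf H(dL_j,dL_j)\big)=2\,dL_j$; and $\mathbf H$ induces a positive definite form on the quotient by the normals on the interior of each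 face. Orthotoric metrics: given $y_1<y_2<x_1<x_2$ and smooth functions $A(x)>0$ on $(x_1,x_2)$ and $B(y)>0$ on $(y_1,y_2)$, put for $x\in(x_1,x_2)$, $y\in(y_1,y_2)$, with $t_1',t_2'$ angular coordinates on $\mathbb T^2$, $$g=(x-y)\Big(\frac{dx^2}{A(x)}+\frac{dy^2}{B(y)}\Big)+\frac1{x-y}\Big(A(x)(dt_1'+y\,dt_2')^2+B(y)(dt_1'+x\,dt_2')^2\Big),$$ $$\omega=dx\wedge(dt_1'+y\,dt_2')+dy\wedge(dt_1'+x\,dt_2').$$ The momentum coordinates are $\mu_1=x+y$, $\mu_2=xy$, and the momentum image is the interior of the quadrilateral with facets on the lines $x_i^2-\mu_1x_i+\mu_2=0$ and $y_j^2-\mu_1y_j+\mu_2=0$ ($i,j=1,2$). An orthotoric metric on $\Delta$ is one of this form after an affine identification of $\Delta$ with such a quadrilateral. *)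

(* Defs.v *)
From HB Require Import structures.
From mathcomp Require Import all_boot all_order all_algebra.
From mathcomp Require Import all_classical all_reals all_analysis.

Set Implicit Arguments.
Unset Strict Implicit.
Unset Printing Implicit Defensive.

Import Order.TTheory GRing.Theory Num.Theory.
Import numFieldNormedType.Exports.

#[global] Open Scope classical_set_scope.
#[global] Open Scope ring_scope.

(** * Smooth functions *)

Definition partial (R : realType) (n : nat) (i : 'I_n) (f : 'rV[R]_n -> R) :
    'rV[R]_n -> R :=
  fun p => 'D_(delta_mx 0 i) f p.

Fixpoint partials (R : realType) (n : nat) (s : seq 'I_n)
    (f : 'rV[R]_n -> R) : 'rV[R]_n -> R :=
  if s is i :: s' then partial i (partials s' f) else f.

(* C^oo on U; only meant for open U. *)
Definition smooth_on (R : realType) (n : nat) (U : set 'rV[R]_n)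
    (f : 'rV[R]_n -> R) : Prop :=
  forall (s : seq 'I_n) (p : 'rV[R]_n), U p -> differentiable (partials s f) p.

Definition smooth_mx_on (R : realType) (n k l : nat) (U : set 'rV[R]_n)
    (f : 'rV[R]_n -> 'M[R]_(k, l)) : Prop :=
  forall i j, smooth_on U (fun p => f p i j).

Definition smooth1_on (R : realType) (U : set R) (f : R -> R) : Prop :=
  forall (k : nat) (x : R), U x -> derivable (f^`(k))%classic x 1.

(** * Quadrilaterals and labels *)

(* The pair l stands for the affine function mu |-> <l.1, mu> + l.2, whose
   differential is l.1. *)
Notation affine_fun R := ('rV[R]_2 * R)%type.

Definition aeval (R : realType) (l : affine_fun R) (mu : 'rV[R]_2) : R :=
  (l.1 *m mu^T) 0 0 + l.2.

Definition face (R : realType) (Delta : set 'rV[R]_2) (l : affine_fun R) :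
    set 'rV[R]_2 :=
  Delta `&` [set mu | aeval l mu = 0].

Definition is_facet (R : realType) (Delta F : set 'rV[R]_2) : Prop :=
  exists l : affine_fun R,
    [/\ l.1 != 0,
        forall mu, Delta mu -> 0 <= aeval l mu,
        F = face Delta l &
        exists p q, [/\ F p, F q & p != q]].

Definition parallel (R : realType) (F G : set 'rV[R]_2) : Prop :=
  exists u : 'rV[R]_2,
    [/\ u != 0,
        forall p q, F p -> F q -> exists c : R, q - p = c *: u &
        forall p q, G p -> G q -> exists c : R, q - p = c *: u].

Notation label R := ('I_4 -> affine_fun R).

Definition is_label (R : realType) (Delta : set 'rV[R]_2) (L : label R) : Prop :=
  [/\ Delta = [set mu | forall j, 0 <= aeval (L j) mu],
      forall F, is_facet Delta F <-> exists j, F = face Delta (L j) &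
      injective (fun j => face Delta (L j))].

(* Compact, two-dimensional, and cut out by one affine inequality for each of
   exactly four facets (hence convex). *)
Definition convex_quadrilateral (R : realType) (Delta : set 'rV[R]_2) : Prop :=
  [/\ compact Delta, Delta^° !=set0 & exists L : label R, is_label Delta L].

(** * The Abreu-Guillemin boundary conditions *)

(* H is regarded as a field of bilinear forms on covectors (row vectors):
   H(u, v) = u H v^T. *)
Definition bil (R : realType) (n : nat) (H : 'M[R]_n) (u v : 'rV[R]_n) : R :=
  (u *m H *m v^T) 0 0.

(* Only the values of H on the interior of Delta matter; Hb is its extension.
   The last clause is positivity on the quotient by the normals: mu ranges over
   all of Delta, and the rows of the 4 x 2 matrix span the normals of the face
   whose relative interior contains mu. *)
Definition abreu_guillemin (R : realType) (Delta : set 'rV[R]_2) (L : label R)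
    (H : 'rV[R]_2 -> 'M[R]_2) : Prop :=
  exists (U : set 'rV[R]_2) (Hb : 'rV[R]_2 -> 'M[R]_2),
    [/\ [/\ open U, Delta `<=` U, smooth_mx_on U Hb &
            forall mu, Delta^° mu -> Hb mu = H mu],
        forall mu j, face Delta (L j) mu ->
          (forall v, bil (Hb mu) (L j).1 v = 0) /\
          (forall i, partial i (fun nu => bil (Hb nu) (L j).1 (L j).1) mu =
                     2 * (L j).1 0 i) &
        forall mu v, Delta mu ->
          ~~ (v <= \matrix_(j < 4)
                     (if aeval (L j) mu == 0 then (L j).1 else 0))%MS ->
          0 < bil (Hb mu) v v].

(** * Riemannian and Kaehler geometry in a coordinate chart *)

(* A metric g, and a 2-form w, are given by their matrices on the coordinate
   fields: g i j = g(d_i, d_j), w i j = w(d_i, d_j). A 1-form is a row vector. *)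

(* christoffel g k i j is Gamma^k_ij *)
Definition christoffel (R : realType) (n : nat) (g : 'rV[R]_n -> 'M[R]_n)
    (k i j : 'I_n) (p : 'rV[R]_n) : R :=
  2^-1 * \sum_l invmx (g p) k l *
    (partial i (fun q => g q j l) p + partial j (fun q => g q i l) p
     - partial l (fun q => g q i j) p).

Definition ricci (R : realType) (n : nat) (g : 'rV[R]_n -> 'M[R]_n)
    (p : 'rV[R]_n) : 'M[R]_n :=
  \matrix_(i, j)
    (\sum_k (partial k (christoffel g k i j) p
             - partial j (christoffel g k i k) p)
     + \sum_k \sum_l
         (christoffel g k k l p * christoffel g l i j p
          - christoffel g k j l p * christoffel g l i k p)).

Definition scalar_curvature (R : realType) (n : nat) (g : 'rV[R]_n -> 'M[R]_n)
    (p : 'rV[R]_n) : R :=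
  \tr (invmx (g p) *m ricci g p).

(* The almost complex structure with w = g(J -, -), acting on vectors as
   row vectors: J d_i = \sum_j (J i j) d_j. *)
Definition cplx_struct (R : realType) (n : nat) (g w : 'rV[R]_n -> 'M[R]_n)
    (p : 'rV[R]_n) : 'M[R]_n :=
  w p *m invmx (g p).

(* rho = Ric(J -, -) *)
Definition ricci_form (R : realType) (n : nat) (g w : 'rV[R]_n -> 'M[R]_n)
    (p : 'rV[R]_n) : 'M[R]_n :=
  cplx_struct g w p *m ricci g p.

(* d^c = J d J^-1 on functions, where J acts on 1-forms by
   J a = a o J^-1 = - a o J, so that d d^c = 2i d dbar. *)
Definition dc (R : realType) (n : nat) (g w : 'rV[R]_n -> 'M[R]_n)
    (f : 'rV[R]_n -> R) (p : 'rV[R]_n) : 'rV[R]_n :=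
  \row_i (- \sum_j cplx_struct g w p i j * partial j f p).

Definition ext_d1 (R : realType) (n : nat) (a : 'rV[R]_n -> 'rV[R]_n)
    (p : 'rV[R]_n) : 'M[R]_n :=
  \matrix_(i, j)
    (partial i (fun q => a q 0 j) p - partial j (fun q => a q 0 i) p).

Definition closed2_on (R : realType) (n : nat) (U : set 'rV[R]_n)
    (w : 'rV[R]_n -> 'M[R]_n) : Prop :=
  forall p i j k, U p ->
    partial i (fun q => w q j k) p + partial j (fun q => w q k i) p
    + partial k (fun q => w q i j) p = 0.

Definition wedge11 (R : realType) (n : nat) (a b : 'rV[R]_n) : 'M[R]_n :=
  a^T *m b - b^T *m a.

Definition c0 : 'I_4 := @Ordinal 4 0 isT.
Definition c1 : 'I_4 := @Ordinal 4 1 isT.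
Definition c2 : 'I_4 := @Ordinal 4 2 isT.
Definition c3 : 'I_4 := @Ordinal 4 3 isT.

(* The coefficient of a /\ b on the coordinate volume form of R^4. *)
Definition wedge22 (R : realType) (a b : 'M[R]_4) : R :=
  a c0 c1 * b c2 c3 - a c0 c2 * b c1 c3 + a c0 c3 * b c1 c2
  + a c1 c2 * b c0 c3 - a c1 c3 * b c0 c2 + a c2 c3 * b c0 c1.

(** * Orthotoric metrics *)

Record orthotoric (R : realType) := Orthotoric {
  ox1 : R; ox2 : R; oy1 : R; oy2 : R;
  oA : R -> R; oB : R -> R;
  o_order : [/\ oy1 < oy2, oy2 < ox1 & ox1 < ox2];
  oA_smooth : smooth1_on `]ox1, ox2[ oA;
  oB_smooth : smooth1_on `]oy1, oy2[ oB;
  oA_gt0 : forall x, ox1 < x < ox2 -> 0 < oA x;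
  oB_gt0 : forall y, oy1 < y < oy2 -> 0 < oB y }.

(* The coordinates c0, c1, c2, c3 are x, y, t'_1, t'_2. The torus directions
   are unrolled to R^2. *)
Definition odom (R : realType) (O : orthotoric R) : set 'rV[R]_4 :=
  [set p | ox1 O < p 0 c0 < ox2 O /\ oy1 O < p 0 c1 < oy2 O].

Definition dcoord (R : realType) (i : 'I_4) : 'rV[R]_4 := delta_mx 0 i.

(* dt'_1 + s dt'_2 *)
Definition otheta (R : realType) (s : R) : 'rV[R]_4 :=
  dcoord R c2 + s *: dcoord R c3.

Definition sq1 (R : realType) (n : nat) (a : 'rV[R]_n) : 'M[R]_n := a^T *m a.

Definition omet (R : realType) (O : orthotoric R) (p : 'rV[R]_4) : 'M[R]_4 :=
  let x := p 0 c0 in let y := p 0 c1 in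
  (x - y) *: ((oA O x)^-1 *: sq1 (dcoord R c0) + (oB O y)^-1 *: sq1 (dcoord R c1))
  + (x - y)^-1 *: (oA O x *: sq1 (otheta y) + oB O y *: sq1 (otheta x)).

Definition oform (R : realType) (p : 'rV[R]_4) : 'M[R]_4 :=
  let x := p 0 c0 in let y := p 0 c1 in
  wedge11 (dcoord R c0) (otheta y) + wedge11 (dcoord R c1) (otheta x).

Definition omoment (R : realType) (x y : R) : 'rV[R]_2 :=
  \row_(i < 2) [:: x + y; x * y]`_i.

(* The closed quadrilateral with sides on the lines s^2 - mu_1 s + mu_2 = 0,
   s = x_1, x_2, y_1, y_2. *)
Definition oquad (R : realType) (O : orthotoric R) : set 'rV[R]_2 :=
  [set mu | exists x y : R,
     [/\ ox1 O <= x <= ox2 O, oy1 O <= y <= oy2 O & mu = omoment x y]].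

(* mu |-> mu M + b identifies Delta with the orthotoric quadrilateral. *)
Definition affine_identification (R : realType) (Delta : set 'rV[R]_2)
    (O : orthotoric R) (M : 'M[R]_2) (b : 'rV[R]_2) : Prop :=
  M \in unitmx /\ [set mu *m M + b | mu in Delta] = oquad O.

(* Row i holds the Killing field K_i with momentum mu_i, the i-th coordinate on
   Delta. As (x + y, xy)_j = \sum_i mu_i M_ij + b_j is the momentum of
   d/dt'_j, one has d/dt'_j = \sum_i M_ij K_i. *)
Definition killing (R : realType) (M : 'M[R]_2) : 'M[R]_(2, 4) :=
  row_mx (0 : 'M[R]_2) (invmx M)^T.

(* H is the matrix function on the interior of Delta of inner products of the
   Killing fields K_i. *)
Definition killing_gram (R : realType) (O : orthotoric R) (M : 'M[R]_2)
    (b : 'rV[R]_2) (H : 'rV[R]_2 -> 'M[R]_2) : Prop :=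
  forall (p : 'rV[R]_4) (mu : 'rV[R]_2), odom O p ->
    mu *m M + b = omoment (p 0 c0) (p 0 c1) ->
    H mu = killing M *m omet O p *m (killing M)^T.

(* Smooth 2-forms on (interior of Delta) x T^2. No lattice is singled out, so
   they are taken invariant under all translations of the t'-coordinates. *)
Definition two_form (R : realType) (O : orthotoric R)
    (theta : 'rV[R]_4 -> 'M[R]_4) : Prop :=
  [/\ forall p, odom O p -> (theta p)^T = - theta p,
      smooth_mx_on (odom O) theta &
      forall p (s : 'rV[R]_2), odom O p ->
        theta (p + row_mx (0 : 'rV[R]_2) s) = theta p].

Definition closed_primitive_11 (R : realType) (O : orthotoric R)
    (theta : 'rV[R]_4 -> 'M[R]_4) : Prop :=
  [/\ two_form O theta,
      closed2_on (odom O) theta,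
      forall p, odom O p -> wedge22 (theta p) (oform p) = 0 &
      forall p, odom O p ->
        let J := cplx_struct (omet O) (@oform R) p in
        J *m theta p *m J^T = theta p].

(* (1/2) d d^c R /\ w = theta /\ theta + rho /\ rho *)
Definition curvature_equation (R : realType) (O : orthotoric R)
    (theta : 'rV[R]_4 -> 'M[R]_4) : Prop :=
  let g := omet O in let w := @oform R in
  forall p, odom O p ->
    2^-1 * wedge22 (ext_d1 (dc g w (scalar_curvature g)) p) (w p) =
    wedge22 (theta p) (theta p)
    + wedge22 (ricci_form g w p) (ricci_form g w p).

(** * Two-parameter families of labels *)

(* The parameter domain is a cone, so that each value of t_1 / t_2 in I is
   attained along a whole ray. *)
Definition params (R : realType) (I : set R) : set (R * R) :=
  [set t | [/\ 0 < t.1, 0 < t.2 & I (t.1 / t.2)]].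

Definition two_parameter_family (R : realType) (I : set R)
    (L : R * R -> label R) : Prop :=
  [/\ is_interval I,
      exists r s, [/\ I r, I s, 0 < r & r < s],
      forall t u, params I t -> params I u -> L t = L u -> t = u &
      forall j, {within params I, continuous (fun t => L t j)}].

(* Main.v *)
From HB Require Import structures.
Require Import Defs.
From mathcomp Require Import all_boot all_order all_algebra.
From mathcomp Require Import all_classical all_reals all_analysis.
From mathcomp Require Import ring lra.
Import Order.TTheory GRing.Theory Num.Theory.
Import numFieldNormedType.Exports.

Set Implicit Arguments.
Unset Strict Implicit.
Unset Printing Implicit Defensive.

Local Open Scope classical_set_scope.
Local Open Scope ring_scope.

(** A parabola touches the four side lines of the quadrilateral and the line at
    infinity; in affine coordinates adapted to it the side lines are
    s^2 - s mu_1 + mu_2 = 0 for four values y1 < y2 < x1 < x2 of s, so that the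
    quadrilateral is an orthotoric one. For the quadratic profile functions
    A = t_1 (x - x1) (x2 - x) and B = t_2 (y - y1) (y2 - y) one finds
    R = 2 (t_1 + t_2) / (x - y), and the curvature equation holds with
    theta = c (dx /\ th_y - dy /\ th_x) / (x - y)^2 exactly when c^2 is a
    certain quadratic form in (t_1, t_2), where th_s = dt'_1 + s dt'_2. Because
    [y1, y2] and [x1, x2] are disjoint, this form is positive between two
    positive values of t_1 / t_2, and it vanishes at these two values. *)

(** * Symbolic partial derivatives *)

(** The touching parameters must come out in the right order. Compactness makes three of the four
    normals positively dependent, so these sides bound a triangle and c_0 l_0 + c_1 l_1 + c_2 l_2 =
    1 with c_j > 0. Write the fourth side as p_0 l_0 + p_1 l_1 + p_2 l_2: exactly one p_j is
    negative, since this side cuts off one corner. The four parameters are 0 and the c_j / p_j; one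
    is negative, two are positive, and they are distinct because no two sides are parallel. The
    profiles are quadratic so that A'' and B'' are constant: the difference of (1/2) d d^c R /\
    omega and rho /\ rho then collapses to a constant times (x - y)^-3, the shape of theta /\ theta.
    The boundary conditions are met for all positive t_1, t_2 by rescaling the label, so only the
    curvature equation restricts t_1 / t_2. The definitions differentiate actual functions, several
    times over. Functions are therefore reified as expressions with a symbolic derivative, correct
    on the open chart, and every tensor identity becomes a rational identity for [field]. *)

Inductive expr (R : realType) (n : nat) : Type :=
| ECst of R
| EVar of 'I_n
| EFn of (R -> R) & nat & 'I_n
| EAdd of expr R n & expr R n
| EMul of expr R n & expr R n
| EInv of expr R n
| ESqrt of expr R n.

Arguments ECst {R n}.
Arguments EVar {R n}.

Fixpoint eval (R : realType) (n : nat) (e : expr R n) (p : 'rV[R]_n) : R :=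
  match e with
  | ECst c => c
  | EVar i => p 0 i
  | EFn f k i => (f^`(k))%classic (p 0 i)
  | EAdd e1 e2 => eval e1 p + eval e2 p
  | EMul e1 e2 => eval e1 p * eval e2 p
  | EInv e1 => (eval e1 p)^-1
  | ESqrt e1 => Num.sqrt (eval e1 p)
  end.

(** The [EFn] clause asks for derivatives of all orders, whatever the order in the expression, so
    that regularity is inherited by [dexpr]. *)
Fixpoint regular_at (R : realType) (n : nat) (e : expr R n) (p : 'rV[R]_n) :
    Prop :=
  match e with
  | ECst _ | EVar _ => True
  | EFn f _ i => forall m, derivable (f^`(m))%classic (p 0 i) 1
  | EAdd e1 e2 | EMul e1 e2 => regular_at e1 p /\ regular_at e2 p
  | EInv e1 => regular_at e1 p /\ eval e1 p != 0
  | ESqrt e1 => regular_at e1 p /\ 0 < eval e1 p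
  end.

Fixpoint dexpr (R : realType) (n : nat) (i : 'I_n) (e : expr R n) : expr R n :=
  match e with
  | ECst _ => ECst 0
  | EVar j => ECst (i == j)%:R
  | EFn f k j => if i == j then EFn f k.+1 j else ECst 0
  | EAdd e1 e2 => EAdd (dexpr i e1) (dexpr i e2)
  | EMul e1 e2 => EAdd (EMul (dexpr i e1) e2) (EMul e1 (dexpr i e2))
  | EInv e1 => EMul (EMul (ECst (-1)) (dexpr i e1)) (EInv (EMul e1 e1))
  | ESqrt e1 => EMul (dexpr i e1) (EInv (EMul (ECst 2) (ESqrt e1)))
  end.

Lemma regular_dexpr (R : realType) (n : nat) (i : 'I_n) (e : expr R n) p :
  regular_at e p -> regular_at (dexpr i e) p.
Proof.
elim: e => [c|j|f k j|e1 IH1 e2 IH2|e1 IH1 e2 IH2|e1 IH1|e1 IH1] //=.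
- by case: (i == j).
- by move=> [/IH1 ? /IH2 ?].
- by move=> [r1 r2]; do !split => //; [exact: IH1|exact: IH2].
- by move=> [r1 n0]; do !split => //; [exact: IH1|rewrite mulf_neq0].
- move=> [r1 p0]; do !split => //; first exact: IH1.
  by rewrite mulf_neq0 // gt_eqF // sqrtr_gt0.
Qed.

Lemma is_diff_coord_row (R : realType) (n : nat) (j : 'I_n) (p : 'rV[R]_n) :
  is_diff p (fun q : 'rV[R]_n => q 0 j) (fun q : 'rV[R]_n => q 0 j).
Proof.
pose c : 'rV[R]_n -> R := fun q => q 0 j.
have lin : linear (c : 'rV[R]_n -> R^o) by move=> a u v; rewrite /c !mxE.
pose m := GRing.isLinear.Build R 'rV[R]_n R^o *:%R (c : 'rV[R]_n -> R^o) lin.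
pose l : {linear 'rV[R]_n -> R^o} := HB.pack (c : 'rV[R]_n -> R^o) m.
have cl : continuous l by exact: coord_continuous.
apply: DiffDef; first exact: (linear_differentiable (f := l)).
by have -> := diff_lin p cl.
Qed.

Lemma is_diff_comp1 (R : realType) (V : normedModType R) (f : V -> R)
    (h : R -> R) (df : V -> R) (dh : R) (p : V) :
  is_diff p f df -> is_derive (f p) 1 h dh ->
  is_diff p (h \o f) (fun v => dh * df v).
Proof.
move=> [dif <-] [dh1 dhE].
have difh : differentiable h (f p) by exact/derivable1_diffP.
apply: DiffDef; first exact: differentiable_comp.
rewrite diff_comp//; apply/funext => v /=.
by rewrite deriv1E // -dhE derive1E -[RHS]mulrC.
Qed.

(** The induction runs on the full differential, not on partial derivatives: [smooth_on] asks for
    differentiability, and the partials are its values on basis vectors. *)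
Lemma is_diff_eval (R : realType) (n : nat) (e : expr R n) p :
  regular_at e p ->
  is_diff p (eval e) (fun v => \sum_i v 0 i * eval (dexpr i e) p).
Proof.
elim: e => [c|j|f k j|e1 IH1 e2 IH2|e1 IH1 e2 IH2|e1 IH1|e1 IH1] /=.
- move=> _; apply: is_diff_eq.
  by apply/funext => v; rewrite big1 // => i _; rewrite mulr0.
- move=> _; apply: (@is_diff_eq _ _ _ _ _ _ _ (is_diff_coord_row j p)).
  apply/funext => v; rewrite (bigD1 j) //= eqxx mulr1 big1 ?addr0 // => i ij.
  by rewrite (negbTE ij) mulr0.
- move=> fk.
  have D1 : is_derive (p 0 j) 1 (f^`(k))%classic ((f^`(k.+1))%classic (p 0 j)).
    by split => //; rewrite derive1nS derive1E.
  apply: (@is_diff_eq _ _ _ _ _ _ _ (is_diff_comp1 (is_diff_coord_row j p) D1)).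
  apply/funext => v; rewrite (bigD1 j) //= eqxx /= mulrC big1 ?addr0 // => i ij.
  by rewrite (negbTE ij) /= mulr0.
- move=> [/IH1 d1 /IH2 d2].
  apply: (@is_diff_eq _ _ _ _ _ _ _ (is_diffD d1 d2)).
  by apply/funext => v; rewrite fctE -big_split /=; apply: eq_bigr => i _; ring.
- move=> [/IH1 d1 /IH2 d2].
  apply: (@is_diff_eq _ _ _ _ _ _ _ (is_diffM d1 d2)).
  apply/funext => v; rewrite /= !fctE /GRing.scale /= !mulr_sumr -big_split /=.
  by apply: eq_bigr => i _; ring.
- move=> [/IH1 d1 n0].
  have D1 : is_derive (eval e1 p) 1 (@GRing.inv R)
      (- (eval e1 p * eval e1 p)^-1).
    split; first exact: derivableV.
    by rewrite deriveV // derive_id /GRing.scale /= mulr1 -expr2.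
  apply: (@is_diff_eq _ _ _ _ _ _ _ (is_diff_comp1 d1 D1)).
  apply/funext => v; rewrite mulr_sumr; apply: eq_bigr => i _.
  ring.
- move=> [/IH1 d1 n0].
  apply: (@is_diff_eq _ _ _ _ _ _ _ (is_diff_comp1 d1 (is_derive1_sqrt n0))).
  apply/funext => v; rewrite mulr_sumr; apply: eq_bigr => i _; ring.
Qed.

Lemma partial_eval (R : realType) (n : nat) (i : 'I_n) (e : expr R n) p :
  regular_at e p -> partial i (eval e) p = eval (dexpr i e) p.
Proof.
move=> /is_diff_eval[dif dE]; rewrite /partial deriveE // dE.
rewrite (bigD1 i) //= big1 ?addr0 => [|j ji]; rewrite mxE eqxx /=.
  by rewrite eqxx mul1r.
by rewrite (negbTE ji) mul0r.
Qed.

Lemma partial_near (R : realType) (n : nat) (i : 'I_n) (f g : 'rV[R]_n -> R)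
    (U : set 'rV[R]_n) p :
  open U -> U p -> (forall q, U q -> f q = g q) -> partial i f p = partial i g p.
Proof.
move=> oU Up fg; rewrite /partial; apply: near_eq_derive.
have := open_nbhs_nbhs (conj oU Up).
by apply: filterS => q /fg.
Qed.

(** Formulas for the metric, the Christoffel symbols and R hold only on an open chart.
    Differentiation being local, they may still be differentiated symbolically there, one order
    after another. *)
Lemma partial_eval_on (R : realType) (n : nat) (i : 'I_n) (f : 'rV[R]_n -> R)
    (e : expr R n) (U : set 'rV[R]_n) p :
  open U -> U p -> (forall q, U q -> f q = eval e q) -> regular_at e p ->
  partial i f p = eval (dexpr i e) p.
Proof. by move=> oU Up fe re; rewrite (partial_near i oU Up fe) partial_eval. Qed.

(** The first-order expansion of f at p is also one of g, and the differential is determined by the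
    expansion. *)
Lemma near_eq_differentiable (R : realType) (V W : normedModType R)
    (f g : V -> W) (p : V) :
  (\forall q \near p, f q = g q) -> differentiable f p -> differentiable g p.
Proof.
move=> fg df.
have E : g \o shift p = cst (g p) + 'd f p +o_ 0 id.
  apply/eqaddoP => e e0.
  have /eqaddoP/(_ e e0) := diff_locally df.
  have fg0 : \forall h \near (0 : V), f (h + p) = g (h + p).
    by rewrite (near_shift p) /= sub0r; near do rewrite /= subrK.
  apply: filterS2 fg0 => h /= fgh.
  by rewrite /= !fctE /= fgh (nbhs_singleton fg).
have dE : 'd g p = 'd f p :> (V -> W).
  by apply: diff_unique E; exact: diff_continuous.
by apply/diff_locallyP; rewrite dE; split => //; exact: diff_continuous.
Unshelve. all: by end_near. Qed.

(** Iterated partials of a regular expression are again regular expressions, so one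
    differentiability statement serves all orders. *)
Lemma smooth_on_eval (R : realType) (n : nat) (U : set 'rV[R]_n)
    (f : 'rV[R]_n -> R) (e : expr R n) :
  open U -> (forall q, U q -> f q = eval e q) ->
  (forall q, U q -> regular_at e q) -> smooth_on U f.
Proof.
move=> oU fe re s.
have [e' [fe' re']] : exists e' : expr R n,
    (forall q, U q -> partials s f q = eval e' q) /\
    (forall q, U q -> regular_at e' q).
  elim: s => [|i s [e' [fe' re']]]; first by exists e.
  exists (dexpr i e'); split=> q Uq; last exact/regular_dexpr/re'.
  by rewrite /= (partial_eval_on i oU Uq fe' (re' q Uq)).
move=> p Up.
have [dif _] := is_diff_eval (re' p Up).
have E : \forall q \near p, eval e' q = partials s f q.
  by have := open_nbhs_nbhs (conj oU Up); apply: filterS => q /fe'.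
exact: near_eq_differentiable E dif.
Qed.

(** * Curvature of orthotoric metrics *)

Lemma ord4_ind (P : 'I_4 -> Prop) :
  P c0 -> P c1 -> P c2 -> P c3 -> forall i, P i.
Proof.
move=> P0 P1 P2 P3; case=> -[|[|[|[|//]]]] lt_i.
- by rewrite (_ : Ordinal _ = c0) //; exact: val_inj.
- by rewrite (_ : Ordinal _ = c1) //; exact: val_inj.
- by rewrite (_ : Ordinal _ = c2) //; exact: val_inj.
- by rewrite (_ : Ordinal _ = c3) //; exact: val_inj.
Qed.

Lemma sum_ord4 (V : nmodType) (F : 'I_4 -> V) :
  \sum_i F i = F c0 + F c1 + F c2 + F c3.
Proof.
rewrite !big_ord_recr big_ord0 /= add0r.
by congr (F _ + F _ + F _ + F _); exact: val_inj.
Qed.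

Definition entry4 (T : Type) (d : T) (rows : seq (seq T)) (i j : 'I_4) : T :=
  nth d (nth [::] rows i) j.

(** Derived from the other constructors, so that [dexpr] and its correctness proof need no extra
    cases. *)
Definition ESub (R : realType) (n : nat) (e f : expr R n) : expr R n :=
  EAdd e (EMul (ECst (-1)) f).
Definition EDiv (R : realType) (n : nat) (e f : expr R n) : expr R n :=
  EMul e (EInv f).

Local Notation Xe := (EVar c0).
Local Notation Ye := (EVar c1).
Local Notation De := (ESub Xe Ye).
Local Notation Z := (ECst 0).

Definition metric_expr (R : realType) (O : orthotoric R) : 'I_4 -> 'I_4 -> expr R 4 :=
  let A := EFn (oA O) 0 c0 in let B := EFn (oB O) 0 c1 in
  let g23 := EDiv (EAdd (EMul A Ye) (EMul B Xe)) De in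
  entry4 Z
    [:: [:: EDiv De A; Z; Z; Z];
        [:: Z; EDiv De B; Z; Z];
        [:: Z; Z; EDiv (EAdd A B) De; g23];
        [:: Z; Z; g23; EDiv (EAdd (EMul A (EMul Ye Ye)) (EMul B (EMul Xe Xe))) De]].

Lemma sq1E (R : realType) (n : nat) (a : 'rV[R]_n) :
  sq1 a = \matrix_(i, j) (a 0 i * a 0 j).
Proof. by apply/matrixP => i j; rewrite !mxE big_ord1 mxE. Qed.

Lemma omet_expr (R : realType) (O : orthotoric R) p i j :
  omet O p i j = eval (metric_expr O i j) p.
Proof.
rewrite /omet !sq1E !mxE eqxx /=.
by elim/ord4_ind: i; elim/ord4_ind: j => /=; rewrite ?mulN1r; ring.
Qed.

Lemma open_odom (R : realType) (O : orthotoric R) : open (odom O).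
Proof.
have oc (i : 'I_4) (a b : R) : open [set p : 'rV[R]_4 | a < p 0 i < b].
  have -> : [set p : 'rV[R]_4 | a < p 0 i < b] =
      (fun p : 'rV[R]_4 => p 0 i) @^-1` `]a, b[.
    by apply/seteqP; split => p /=; rewrite in_itv.
  apply: open_comp => [p _|]; first exact: coord_continuous.
  exact: interval_open.
exact: openI (oc c0 _ _) (oc c1 _ _).
Qed.

(** * Inverse metric and Christoffel symbols *)

Section OrthotoricCurvature.
Variables (R : realType) (O : orthotoric R).

Lemma odom_gt0 p : odom O p ->
  [/\ 0 < oA O (p 0 c0), 0 < oB O (p 0 c1) & 0 < p 0 c0 - p 0 c1].
Proof.
move=> [xr yr]; split; [exact: oA_gt0|exact: oB_gt0|].
by have [_ yx _] := o_order O; move: xr yr => /andP[? _] /andP[_ ?]; lra.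
Qed.

Lemma odom_neq0 p : odom O p ->
  [/\ oA O (p 0 c0) != 0, oB O (p 0 c1) != 0 & p 0 c0 - p 0 c1 != 0].
Proof. by move=> /odom_gt0[a b d]; split; rewrite gt_eqF. Qed.

Lemma oA_derivable p : odom O p ->
  forall k, derivable ((oA O)^`(k))%classic (p 0 c0) 1.
Proof. by move=> [xr _] k; apply: oA_smooth; rewrite /= in_itv. Qed.

Lemma oB_derivable p : odom O p ->
  forall k, derivable ((oB O)^`(k))%classic (p 0 c1) 1.
Proof. by move=> [_ yr] k; apply: oB_smooth; rewrite /= in_itv. Qed.

Ltac regular hp :=
  have [A0 B0 D0] := odom_neq0 hp;
  have dA := oA_derivable hp; have dB := oB_derivable hp;
  rewrite /=; repeat split => //;
  rewrite ?mulN1r ?mulf_neq0 //; rewrite ?pnatr_eq0.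

Lemma regular_metric p i j : odom O p -> regular_at (metric_expr O i j) p.
Proof. by move=> hp; elim/ord4_ind: i; elim/ord4_ind: j; regular hp. Qed.

(** The torus block of the metric has determinant A B, which explains the denominators. *)
Definition inv_metric (x y A B : R) : 'M[R]_4 :=
  \matrix_(i, j) entry4 0
    [:: [:: A / (x - y); 0; 0; 0];
        [:: 0; B / (x - y); 0; 0];
        [:: 0; 0; (A * y ^+ 2 + B * x ^+ 2) / (A * B * (x - y));
                  - (A * y + B * x) / (A * B * (x - y))];
        [:: 0; 0; - (A * y + B * x) / (A * B * (x - y));
                  (A + B) / (A * B * (x - y))]] i j.

Lemma invmx_omet p : odom O p ->
  invmx (omet O p) =
  inv_metric (p 0 c0) (p 0 c1) (oA O (p 0 c0)) (oB O (p 0 c1)).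
Proof.
move=> hp; have [A0 B0 D0] := odom_neq0 hp.
set x := p 0 c0; set y := p 0 c1; set A := oA O x; set B := oB O y.
have E : omet O p *m inv_metric x y A B = 1%:M.
  apply/matrixP => i j; rewrite !mxE sum_ord4 !omet_expr /inv_metric !mxE.
  elim/ord4_ind: i; elim/ord4_ind: j; rewrite /entry4 /= -/x -/y -/A -/B mulN1r;
  rewrite ?mul0r ?mulr0 ?add0r ?addr0 //; field; rewrite ?A0 ?B0 ?D0 //.
have [uo _] := mulmx1_unit E.
by rewrite -[LHS]mulmx1 -E mulmxA mulVmx // mul1mx.
Qed.

(** Symbols with an odd number of torus indices vanish, the metric being block diagonal and torus
    invariant. Here [gxij], [gyij] are the x- and y-derivatives of the torus block, [xkj] and [ykj]
    are Gamma^k_xj and Gamma^k_yj, and [xxy], [yxy] are Gamma^x_xy and Gamma^y_xy. One finds gx23 =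
    y gx22 and gy23 = x gy22. *)
Definition christoffel_expr : 'I_4 -> 'I_4 -> 'I_4 -> expr R 4 :=
  let A := EFn (oA O) 0 c0 in let B := EFn (oB O) 0 c1 in
  let A' := EFn (oA O) 1 c0 in let B' := EFn (oB O) 1 c1 in
  let half e := EMul (ECst 2^-1) e in
  let iD := EInv De in
  let AB := EAdd A B in
  let D2 := EMul De De in
  let gx22 := ESub (EDiv A' De) (EDiv AB D2) in
  let gx23 := EMul Ye gx22 in
  let gx33 := ESub (EDiv (EAdd (EMul A' (EMul Ye Ye)) (EMul (ECst 2) (EMul B Xe))) De)
    (EDiv (EAdd (EMul A (EMul Ye Ye)) (EMul B (EMul Xe Xe))) D2) in
  let gy22 := EAdd (EDiv B' De) (EDiv AB D2) in
  let gy23 := EMul Xe gy22 in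
  let gy33 := EAdd (EDiv (EAdd (EMul B' (EMul Xe Xe)) (EMul (ECst 2) (EMul A Ye))) De)
    (EDiv (EAdd (EMul A (EMul Ye Ye)) (EMul B (EMul Xe Xe))) D2) in
  let cx := EMul (ECst (- 2^-1)) (EDiv A De) in
  let cy := EMul (ECst (- 2^-1)) (EDiv B De) in
  let u := ESub (EDiv A' A) iD in
  let bad := EDiv B (EMul A De) in
  let v := ESub u bad in let w := ESub (EMul u Ye) (EMul bad Xe) in
  let z := EAdd (EDiv B' B) iD in
  let abd := EDiv A (EMul B De) in
  let m := EAdd z abd in let n := EAdd (EMul z Xe) (EMul abd Ye) in
  let x22 := half (EDiv (EMul Xe v) De) in
  let x23 := half (EDiv (ESub (EMul Xe w) Ye) De) in
  let x32 := EMul (ECst (- 2^-1)) (EDiv v De) in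
  let x33 := half (EDiv (ESub (ECst 1) w) De) in
  let y22 := EMul (ECst (- 2^-1)) (EDiv (EMul Ye m) De) in
  let y23 := half (EDiv (ESub Xe (EMul Ye n)) De) in
  let y32 := half (EDiv m De) in
  let y33 := half (EDiv (ESub n (ECst 1)) De) in
  let xxy := EMul (ECst (- 2^-1)) iD in
  let yxy := EMul (ECst 2^-1) iD in
  fun k => entry4 Z (nth [::]
    [:: [:: [:: half (ESub iD (EDiv A' A)); xxy; Z; Z];
            [:: xxy; EMul (ECst (- 2^-1)) (EDiv A (EMul De B)); Z; Z];
            [:: Z; Z; EMul cx gx22; EMul cx gx23];
            [:: Z; Z; EMul cx gx23; EMul cx gx33]];
        [:: [:: half (EDiv B (EMul De A)); yxy; Z; Z];
            [:: yxy; EMul (ECst (- 2^-1)) (EAdd iD (EDiv B' B)); Z; Z];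
            [:: Z; Z; EMul cy gy22; EMul cy gy23];
            [:: Z; Z; EMul cy gy23; EMul cy gy33]];
        [:: [:: Z; Z; x22; x23];
            [:: Z; Z; y22; y23];
            [:: x22; y22; Z; Z];
            [:: x23; y23; Z; Z]];
        [:: [:: Z; Z; x32; x33];
            [:: Z; Z; y32; y33];
            [:: x32; y32; Z; Z];
            [:: x33; y33; Z; Z]]] k).

Lemma regular_christoffel p k i j : odom O p -> regular_at (christoffel_expr k i j) p.
Proof.
by move=> hp; elim/ord4_ind: k; elim/ord4_ind: i; elim/ord4_ind: j; regular hp.
Qed.

Lemma partial_omet p i j l : odom O p ->
  partial i (fun q => omet O q j l) p = eval (dexpr i (metric_expr O j l)) p.
Proof.
move=> hp; apply: (partial_eval_on _ (@open_odom _ O)) => //.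
  by move=> q _; exact: omet_expr.
exact: regular_metric.
Qed.

Lemma christoffel_omet p k i j : odom O p ->
  christoffel (omet O) k i j p = eval (christoffel_expr k i j) p.
Proof.
move=> hp; have [A0 B0 D0] := odom_neq0 hp.
rewrite /christoffel sum_ord4 !partial_omet // invmx_omet // /inv_metric !mxE.
by elim/ord4_ind: k; elim/ord4_ind: i; elim/ord4_ind: j;
  rewrite /entry4 /= ?mulN1r; field; rewrite ?A0 ?B0 ?D0.
Qed.

Lemma partial_christoffel p l k i j : odom O p ->
  partial l (christoffel (omet O) k i j) p = eval (dexpr l (christoffel_expr k i j)) p.
Proof.
move=> hp; apply: (partial_eval_on _ (@open_odom _ O)) => //.
  by move=> q; exact: christoffel_omet.
exact: regular_christoffel.
Qed.

End OrthotoricCurvature.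

(** * Ricci curvature, d d^c R and the closed primitive form *)

Section OrthotoricRicci.
Variables (R : realType) (O : orthotoric R).

Definition ricci_weight1 (x y : R) : R :=
  - 2^-1 * ((oA O)^`()^`()%classic x / (x - y) -
            ((oA O)^`()%classic x + (oB O)^`()%classic y) / (x - y) ^+ 2).
Definition ricci_weight2 (x y : R) : R :=
  - 2^-1 * ((oB O)^`()^`()%classic y / (x - y) +
            ((oA O)^`()%classic x + (oB O)^`()%classic y) / (x - y) ^+ 2).

(** The metric with its A-part multiplied by [l1] and its B-part by [l2]. Thus the two Ricci weights
    are the eigenvalues of the Ricci endomorphism on the two J-invariant planes. *)
Definition ricci_mx (x y A B l1 l2 : R) : 'M[R]_4 :=
  let r23 := (l1 * A * y + l2 * B * x) / (x - y) in
  \matrix_(i, j) entry4 0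
    [:: [:: l1 * (x - y) / A; 0; 0; 0];
        [:: 0; l2 * (x - y) / B; 0; 0];
        [:: 0; 0; (l1 * A + l2 * B) / (x - y); r23];
        [:: 0; 0; r23; (l1 * A * y ^+ 2 + l2 * B * x ^+ 2) / (x - y)]] i j.

Lemma ricci_omet p : odom O p ->
  let x := p 0 c0 in let y := p 0 c1 in
  ricci (omet O) p =
  ricci_mx x y (oA O x) (oB O y) (ricci_weight1 x y) (ricci_weight2 x y).
Proof.
move=> hp x y; have [] := odom_neq0 hp.
have [xE yE] : p 0 c0 = x /\ p 0 c1 = y by [].
rewrite -/x -/y => A0 B0 D0.
apply/matrixP => i j.
rewrite !mxE !sum_ord4 !partial_christoffel // !christoffel_omet //.
rewrite /ricci_weight1 /ricci_weight2.
clearbody x y; elim/ord4_ind: i; elim/ord4_ind: j.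
all: rewrite /entry4 /= ?mulN1r ?xE ?yE; move: A0 B0 D0.
(* Abstracting the values of A, B and their derivatives leaves rational identities in independent
   variables. *)
all: move: (oA O x) (oB O y) => A B.
all: move: ((oA O)^`()%classic x) ((oB O)^`()%classic y) => A1 B1.
all: move: ((oA O)^`()^`()%classic x) ((oB O)^`()^`()%classic y) => A2 B2.
all: move=> A0 B0 D0.
all: by field; rewrite ?A0 ?B0 ?D0.
Qed.

Lemma scalar_curvature_omet p : odom O p ->
  let x := p 0 c0 in let y := p 0 c1 in
  scalar_curvature (omet O) p =
  - ((oA O)^`()^`()%classic x + (oB O)^`()^`()%classic y) / (x - y).
Proof.
move=> hp x y; have [A0 B0 D0] := odom_neq0 hp.
rewrite /scalar_curvature ricci_omet // invmx_omet // /mxtrace sum_ord4 !mxE.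
rewrite !sum_ord4 !mxE /entry4 /= -/x -/y.
(* Each Ricci eigenvalue has multiplicity two; in their sum the first derivatives of A and B
   cancel. *)
transitivity (2 * (ricci_weight1 x y + ricci_weight2 x y)).
  by move: (ricci_weight1 x y) (ricci_weight2 x y) => l1 l2; field; rewrite ?A0 ?B0 ?D0.
rewrite /ricci_weight1 /ricci_weight2.
move: ((oA O)^`()^`()%classic x) ((oB O)^`()^`()%classic y) => A2 B2.
move: ((oA O)^`()%classic x) ((oB O)^`()%classic y) => A1 B1.
by field; rewrite ?D0.
Qed.

Lemma oformE (p : 'rV[R]_4) :
  oform p = \matrix_(i, j) entry4 0
    [:: [:: 0; 0; 1; p 0 c1];
        [:: 0; 0; 1; p 0 c0];
        [:: -1; -1; 0; 0];
        [:: - p 0 c1; - p 0 c0; 0; 0]] i j.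
Proof.
rewrite /oform /wedge11; apply/matrixP => i j; rewrite !mxE !big_ord1 !mxE eqxx /=.
by elim/ord4_ind: i; elim/ord4_ind: j; rewrite /entry4 /=; ring.
Qed.

Definition cplx_mx (x y A B : R) : 'M[R]_4 :=
  \matrix_(i, j) entry4 0
    [:: [:: 0; 0; x / A; - A^-1];
        [:: 0; 0; - y / B; B^-1];
        [:: - A / (x - y); - B / (x - y); 0; 0];
        [:: - (y * A) / (x - y); - (x * B) / (x - y); 0; 0]] i j.

Lemma cplx_struct_omet p : odom O p ->
  cplx_struct (omet O) (@oform R) p =
  cplx_mx (p 0 c0) (p 0 c1) (oA O (p 0 c0)) (oB O (p 0 c1)).
Proof.
move=> hp; have [A0 B0 D0] := odom_neq0 hp.
rewrite /cplx_struct invmx_omet // oformE.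
apply/matrixP => i j; rewrite !mxE sum_ord4 !mxE.
elim/ord4_ind: i; elim/ord4_ind: j; rewrite /entry4 /=;
  by field; rewrite ?A0 ?B0 ?D0.
Qed.

(** Here rho = l1 dx /\ th_y + l2 dy /\ th_x, and dx /\ th_y /\ dy /\ th_x is -(x - y) times the
    coordinate volume form. *)
Lemma wedge22_ricci_form p : odom O p ->
  let x := p 0 c0 in let y := p 0 c1 in
  let rho := ricci_form (omet O) (@oform R) p in
  wedge22 rho rho = - 2 * ricci_weight1 x y * ricci_weight2 x y * (x - y).
Proof.
move=> hp x y /=; have [A0 B0 D0] := odom_neq0 hp.
rewrite /ricci_form cplx_struct_omet // ricci_omet // /wedge22 !mxE !sum_ord4 !mxE.
rewrite /entry4 /= -/x -/y; move: (ricci_weight1 x y) (ricci_weight2 x y) => l1 l2.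
by field; rewrite ?A0 ?B0 ?D0.
Qed.

Definition asd_expr (c : R) : 'I_4 -> 'I_4 -> expr R 4 :=
  let k := EDiv (ECst c) (EMul De De) in
  let N e := EMul (ECst (-1)) e in
  entry4 Z
    [:: [:: Z; Z; k; EMul k Ye];
        [:: Z; Z; N k; N (EMul k Xe)];
        [:: N k; k; Z; Z];
        [:: N (EMul k Ye); EMul k Xe; Z; Z]].

(* The closed anti-self-dual form c (dx /\ th_y - dy /\ th_x) / (x - y)^2. *)
Definition asd_form (c : R) (p : 'rV[R]_4) : 'M[R]_4 :=
  \matrix_(i, j) eval (asd_expr c i j) p.

Lemma regular_asd c p i j : odom O p -> regular_at (asd_expr c i j) p.
Proof.
move=> hp; have [_ _ D0] := odom_neq0 hp.
elim/ord4_ind: i; elim/ord4_ind: j => /=; repeat split => //;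
  by rewrite ?mulN1r ?mulf_neq0.
Qed.

(** Opposite multiples of dx /\ th_y and dy /\ th_x are primitive of type (1,1). For a factor f,
    closedness means f_x + f_y = 0 and (x - y) f_x = -2 f, which singles out the multiples of (x -
    y)^-2. *)
Lemma asd_form_closed_primitive_11 c : closed_primitive_11 O (asd_form c).
Proof.
split.
- split.
  + move=> p _; apply/matrixP => i j; rewrite !mxE.
    elim/ord4_ind: i; elim/ord4_ind: j; rewrite /entry4 /= ?mulN1r; ring.
  + move=> i j; apply: (smooth_on_eval (e := asd_expr c i j)).
    * exact: open_odom.
    * by move=> q _; rewrite mxE.
    * by move=> q; exact: regular_asd.
  + move=> p s _.
    have E (i : 'I_4) : (i < 2)%N -> (p + row_mx (0 : 'rV[R]_2) s) 0 i = p 0 i.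
      move=> i2; rewrite !mxE; case: splitP => [k _|k ik]; first by rewrite mxE addr0.
      by move: i2; rewrite ik.
    apply/matrixP => i j; rewrite !mxE.
    by elim/ord4_ind: i; elim/ord4_ind: j; rewrite /= ?E.
- move=> p i j k hp.
  have [_ _ D0] := odom_neq0 hp.
  have E l m n : partial l (fun q => asd_form c q m n) p =
      eval (dexpr l (asd_expr c m n)) p.
    apply: (partial_eval_on _ (@open_odom _ O)) => //.
      by move=> q _; rewrite mxE.
    exact: regular_asd.
  rewrite !E.
  elim/ord4_ind: i; elim/ord4_ind: j; elim/ord4_ind: k;
    by rewrite /= ?mulN1r; field; rewrite ?D0.
- move=> p hp; have [_ _ D0] := odom_neq0 hp.
  by rewrite oformE /wedge22 !mxE /entry4 /= ?mulN1r; field; rewrite ?D0.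
- move=> p hp /=; have [A0 B0 D0] := odom_neq0 hp.
  rewrite cplx_struct_omet //.
  apply/matrixP => i j; rewrite !mxE !sum_ord4 !mxE !sum_ord4 !mxE.
  elim/ord4_ind: i; elim/ord4_ind: j; rewrite /entry4 /= ?mulN1r;
    by field; rewrite ?A0 ?B0 ?D0.
Qed.

Lemma wedge22_asd_form c p : odom O p ->
  wedge22 (asd_form c p) (asd_form c p) = 2 * c ^+ 2 / (p 0 c0 - p 0 c1) ^+ 3.
Proof.
move=> hp; have [_ _ D0] := odom_neq0 hp.
by rewrite /wedge22 !mxE /entry4 /= ?mulN1r; field; rewrite ?D0.
Qed.

Section Quadratic.
Variables (a b : R).
Hypothesis oA2 : (oA O)^`()^`()%classic = cst (- 2 * a).
Hypothesis oB2 : (oB O)^`()^`()%classic = cst (- 2 * b).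

Definition scal_expr : expr R 4 := EDiv (ECst (2 * (a + b))) De.

Lemma scalar_curvature_quadratic p : odom O p ->
  scalar_curvature (omet O) p = eval scal_expr p.
Proof.
move=> hp; have [_ _ D0] := odom_neq0 hp.
rewrite scalar_curvature_omet // oA2 oB2 /= ?mulN1r.
by field; rewrite ?D0.
Qed.

(** d^c R = u th_y + v th_x with u = A R_x / (x - y) and v = B R_y / (x - y). *)
Definition dc_scal_expr : 'I_4 -> expr R 4 :=
  let u := EMul (EDiv (EFn (oA O) 0 c0) De) (dexpr c0 scal_expr) in
  let v := EMul (EDiv (EFn (oB O) 0 c1) De) (dexpr c1 scal_expr) in
  fun i => nth Z [:: Z; Z; EAdd u v; EAdd (EMul Ye u) (EMul Xe v)] i.

Lemma dc_scalar_curvature p i : odom O p ->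
  dc (omet O) (@oform R) (scalar_curvature (omet O)) p 0 i =
  eval (dc_scal_expr i) p.
Proof.
move=> hp; have [A0 B0 D0] := odom_neq0 hp.
have E l : partial l (scalar_curvature (omet O)) p = eval (dexpr l scal_expr) p.
  apply: (partial_eval_on _ (@open_odom _ O)) => //=.
    by move=> q; exact: scalar_curvature_quadratic.
  by rewrite mulN1r.
rewrite mxE cplx_struct_omet // sum_ord4 !E !mxE.
elim/ord4_ind: i; rewrite /entry4 /= ?mulN1r;
  by field; rewrite ?A0 ?B0 ?D0.
Qed.

Lemma ddc_scalar_curvature p : odom O p ->
  let x := p 0 c0 in let y := p 0 c1 in
  2^-1 * wedge22 (ext_d1 (dc (omet O) (@oform R) (scalar_curvature (omet O))) p)
    (oform p) =
  (a + b) * (((oA O)^`()%classic x - (oB O)^`()%classic y) / (x - y) ^+ 2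
             - 2 * (oA O x + oB O y) / (x - y) ^+ 3).
Proof.
move=> hp x y; have [A0 B0 D0] := odom_neq0 hp.
have E l i : partial l (fun q => dc (omet O) (@oform R)
    (scalar_curvature (omet O)) q 0 i) p = eval (dexpr l (dc_scal_expr i)) p.
  apply: (partial_eval_on _ (@open_odom _ O)) => //.
    by move=> q; exact: dc_scalar_curvature.
  have dA := oA_derivable hp; have dB := oB_derivable hp.
  elim/ord4_ind: i => /=; repeat split => //;
  by rewrite ?mulN1r ?mulf_neq0.
rewrite oformE /wedge22 !mxE !E /entry4 /= ?mulN1r -/x -/y.
by field; rewrite ?D0.
Qed.

End Quadratic.
End OrthotoricRicci.

(** * Normal form of a quadrilateral without parallel sides *)

Lemma sum_ord2 (V : nmodType) (F : 'I_2 -> V) : \sum_i F i = F 0 + F 1.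
Proof.
rewrite !big_ord_recr big_ord0 /= add0r.
by congr (F _ + F _); exact: val_inj.
Qed.

Lemma ord2_ind (P : 'I_2 -> Prop) : P 0 -> P 1 -> forall i, P i.
Proof.
move=> P0 P1 [[|[|//]] lt_i].
  by rewrite (_ : Ordinal _ = 0) //; exact: val_inj.
by rewrite (_ : Ordinal _ = 1) //; exact: val_inj.
Qed.

Lemma aevalE (R : realType) (l : affine_fun R) (mu : 'rV[R]_2) :
  aeval l mu = l.1 0 0 * mu 0 0 + l.1 0 1 * mu 0 1 + l.2.
Proof.
by rewrite /aeval mxE sum_ord2 !mxE.
Qed.

Lemma row2P (R : realType) (u v : 'rV[R]_2) :
  u 0 0 = v 0 0 -> u 0 1 = v 0 1 -> u = v.
Proof.
by move=> u0 u1; apply/rowP; elim/ord2_ind.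
Qed.

Definition det2 (R : realType) (u v : 'rV[R]_2) : R :=
  u 0 0 * v 0 1 - u 0 1 * v 0 0.

Definition perp (R : realType) (u : 'rV[R]_2) : 'rV[R]_2 :=
  \row_(i < 2) [:: - u 0 1; u 0 0]`_i.

Lemma perp_neq0 (R : realType) (u : 'rV[R]_2) : u != 0 -> perp u != 0.
Proof.
apply: contra => /eqP /rowP e; apply/eqP; apply: row2P; rewrite mxE.
  by have := e 1; rewrite !mxE.
by have := e 0; rewrite !mxE /= => /eqP; rewrite oppr_eq0 => /eqP.
Qed.

Definition ascale (R : realType) (k : R) (l : affine_fun R) : affine_fun R :=
  (k *: l.1, k * l.2).

Lemma aeval_ascale (R : realType) (k : R) (l : affine_fun R) mu :
  aeval (ascale k l) mu = k * aeval l mu.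
Proof. by rewrite !aevalE /= !mxE; ring. Qed.

Lemma ascaleA (R : realType) (h k : R) (l : affine_fun R) :
  ascale h (ascale k l) = ascale (h * k) l.
Proof. by rewrite /ascale /= scalerA mulrA. Qed.

Definition lab4 (R : realType) (l0 l1 l2 l3 : affine_fun R) : label R :=
  fun j => nth l3 [:: l0; l1; l2; l3] j.

Lemma lab4_eta (R : realType) (L : label R) : L = lab4 (L c0) (L c1) (L c2) (L c3).
Proof. by apply/funext; elim/ord4_ind. Qed.

Lemma det2_eq (R : realType) (l l' : affine_fun R) (p q : 'rV[R]_2) :
  det2 l.1 l'.1 != 0 -> aeval l p = aeval l q -> aeval l' p = aeval l' q -> p = q.
Proof.
rewrite !aevalE /det2 => d0 e e'.
have e1 : l.1 0 0 * (p 0 0 - q 0 0) + l.1 0 1 * (p 0 1 - q 0 1) = 0.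
  by move/addIr/eqP: e; rewrite -subr_eq0 => /eqP <-; ring.
have e2 : l'.1 0 0 * (p 0 0 - q 0 0) + l'.1 0 1 * (p 0 1 - q 0 1) = 0.
  by move/addIr/eqP: e'; rewrite -subr_eq0 => /eqP <-; ring.
(* Cramer's rule: the determinant times a coordinate difference is a combination of [e1] and
   [e2]. *)
apply: row2P; apply/eqP; rewrite -subr_eq0; apply/eqP; apply: (mulfI d0).
  rewrite mulr0 -[RHS](_ : l'.1 0 1 * 0 - l.1 0 1 * 0 = 0); last by ring.
  by rewrite -{1}e1 -e2; ring.
rewrite mulr0 -[RHS](_ : l.1 0 0 * 0 - l'.1 0 0 * 0 = 0); last by ring.
by rewrite -{1}e2 -e1; ring.
Qed.

(** * Labels and side normals *)

Section Labels.
Variables (R : realType) (Delta : set 'rV[R]_2).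

Lemma is_label_comp (L : label R) (s : 'I_4 -> 'I_4) :
  injective s -> is_label Delta L -> is_label Delta (L \o s).
Proof.
move=> sI [DE fE LI]; have [g sK gK] := injF_bij sI; split.
- rewrite DE; apply/seteqP; split=> mu /= H j; first exact: H.
  by rewrite -(gK j); exact: H.
- move=> F; rewrite fE; split=> -[j ->]; last by exists (s j).
  by exists (g j); rewrite /= gK.
- by move=> i j /LI /sI.
Qed.

Lemma face_ascale (k : R) (l : affine_fun R) : k != 0 ->
  face Delta (ascale k l) = face Delta l.
Proof.
move=> k0; rewrite /face; congr (_ `&` _); apply/seteqP; split=> mu /=;
  rewrite aeval_ascale; last by move->; rewrite mulr0.
by move/eqP; rewrite mulf_eq0 (negbTE k0) => /eqP.
Qed.

Lemma is_label_ascale (L L' : label R) (k : 'I_4 -> R) :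
  (forall j, 0 < k j) -> (forall j, L' j = ascale (k j) (L j)) ->
  is_label Delta L -> is_label Delta L'.
Proof.
move=> k0 L'E [DE fE LI].
have faceE j : face Delta (L' j) = face Delta (L j).
  by rewrite L'E face_ascale // gt_eqF.
split.
- by rewrite DE; apply/seteqP; split=> mu /= H j; move: (H j);
    rewrite L'E aeval_ascale pmulr_rge0.
- by move=> F; rewrite fE; split=> -[j ->]; exists j; rewrite faceE.
- by move=> i j; rewrite !faceE => /LI.
Qed.

(** The adjacent transpositions of the sides generate all renumberings, which lets the later sign
    analysis assume a fixed pattern. *)
Lemma is_label_swap01 a b c d :
  is_label Delta (lab4 a b c d) -> is_label Delta (lab4 b a c d).
Proof.
pose s := fun j : 'I_4 => nth c3 [:: c1; c0; c2; c3] j.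
have sI : injective s by elim/ord4_ind; elim/ord4_ind.
move/(is_label_comp sI); congr is_label.
by apply/funext; elim/ord4_ind.
Qed.

Lemma is_label_swap12 a b c d :
  is_label Delta (lab4 a b c d) -> is_label Delta (lab4 a c b d).
Proof.
pose s := fun j : 'I_4 => nth c3 [:: c0; c2; c1; c3] j.
have sI : injective s by elim/ord4_ind; elim/ord4_ind.
move/(is_label_comp sI); congr is_label.
by apply/funext; elim/ord4_ind.
Qed.

Lemma is_label_swap23 a b c d :
  is_label Delta (lab4 a b c d) -> is_label Delta (lab4 a b d c).
Proof.
pose s := fun j : 'I_4 => nth c3 [:: c0; c1; c3; c2] j.
have sI : injective s by elim/ord4_ind; elim/ord4_ind.
move/(is_label_comp sI); congr is_label.
by apply/funext; elim/ord4_ind.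
Qed.

Hypothesis intD : Delta^° !=set0.

Lemma interior_segment (mu v : 'rV[R]_2) : Delta^° mu ->
  exists t : R, 0 < t /\ Delta (mu + t *: v).
Proof.
move=> /= imu.
have cf : {for 0, continuous (fun t : R => mu + t *: v)}.
  move=> /=; apply: cvgD; first exact: cvg_cst.
  exact: scalel_continuous.
have : \forall t \near (0 : R), Delta (mu + t *: v).
  by apply: cf; rewrite scale0r addr0.
move=> /nbhs_ballP[e /= e0 be]; exists (e / 2); split; first lra.
by apply: be; rewrite /ball /= sub0r normrN ger0_norm; lra.
Qed.

(** A move by t along the gradient from an interior point changes l by t times the squared norm of
    the gradient. *)
Lemma affine_eq0_on (l : affine_fun R) :
  (forall mu, Delta mu -> aeval l mu = 0) -> l.1 = 0.
Proof.
move=> l0; have [mu imu] := intD.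
have [t [t0 Dt]] := interior_segment l.1 imu.
have := l0 _ Dt; have := l0 _ (interior_subset imu); rewrite !aevalE !mxE => e1 e2.
have e : t * (l.1 0 0 ^+ 2 + l.1 0 1 ^+ 2) = 0 by lra.
move/eqP: e; rewrite mulf_eq0 gt_eqF //= paddr_eq0 ?sqr_ge0 // !sqrf_eq0.
by move=> /andP[/eqP n0 /eqP n1]; apply: row2P; rewrite mxE.
Qed.

Lemma row2_neq0 (u : 'rV[R]_2) : u != 0 -> 0 < u 0 0 ^+ 2 + u 0 1 ^+ 2.
Proof.
move=> u0; rewrite lt_neqAle addr_ge0 ?sqr_ge0 // andbT eq_sym.
rewrite paddr_eq0 ?sqr_ge0 // !sqrf_eq0; apply: contra u0 => /andP[/eqP u0 /eqP u1].
by apply/eqP; apply: row2P; rewrite mxE.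
Qed.

Lemma face_two_points (L : label R) j : is_label Delta L ->
  exists p q, [/\ face Delta (L j) p, face Delta (L j) q & p != q].
Proof.
move=> [_ fE _]; have /fE[l [_ _ _ [p [q H]]]] : exists k, face Delta (L j) = face Delta (L k).
  by exists j.
by exists p, q.
Qed.

(** A constant [L j] vanishes identically, having a zero on its face. Then the face is all of Delta,
    yet as a facet it lies on a line, contradicting the nonempty interior. *)
Lemma label_neq0 (L : label R) j : is_label Delta L -> (L j).1 != 0.
Proof.
move=> HL; have [_ fE _] := HL; apply/eqP => L0.
have [p [_ [[_ /= p0] _ _]]] := face_two_points j HL.
have Lj mu : aeval (L j) mu = 0.
  by rewrite -p0 !aevalE L0 !mxE; ring.
have /fE[l [l0 _ FE _]] : exists k, face Delta (L j) = face Delta (L k) by exists j.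
case/negP: l0; apply/eqP/affine_eq0_on => mu Dmu.
have : face Delta (L j) mu by split => //=; exact: Lj.
by rewrite FE => -[].
Qed.

(** Proportional normals make both faces run along [perp] of one of them, and distinct indices give
    distinct facets. *)
Lemma label_det2 (L : label R) i j :
  (forall F G : set 'rV[R]_2, is_facet Delta F -> is_facet Delta G ->
     F <> G -> ~ parallel F G) ->
  is_label Delta L -> i != j -> det2 (L i).1 (L j).1 != 0.
Proof.
move=> npar HL ij; apply/eqP => d0.
have [_ fE LI] := HL.
have ni := label_neq0 i HL; have nj := label_neq0 j HL.
have n2i := row2_neq0 ni; have n2j := row2_neq0 nj.
apply: (npar (face Delta (L i)) (face Delta (L j))).
- by apply/fE; exists i.
- by apply/fE; exists j.
- by move=> /LI e; move: ij; rewrite e eqxx.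
have key (u d : 'rV[R]_2) : 0 < u 0 0 ^+ 2 + u 0 1 ^+ 2 ->
    u 0 0 * d 0 0 + u 0 1 * d 0 1 = 0 -> exists c, d = c *: perp u.
  move=> u2 ud.
  exists ((u 0 0 * d 0 1 - u 0 1 * d 0 0) / (u 0 0 ^+ 2 + u 0 1 ^+ 2)).
  move: u2 ud; set a := u 0 0; set b := u 0 1; set x := d 0 0; set y := d 0 1.
  move=> u2 ud; have u20 : a ^+ 2 + b ^+ 2 != 0 by rewrite gt_eqF.
  apply: row2P; rewrite !mxE /= -/a -/b -/x -/y.
    apply: (mulIf u20); rewrite mulrAC divfK //.
    by rewrite -[LHS]subr0 -(mulr0 a) -ud; ring.
  apply: (mulIf u20); rewrite mulrAC divfK //.
  by rewrite -[LHS]subr0 -(mulr0 b) -ud; ring.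
have dir k p q : face Delta (L k) p -> face Delta (L k) q ->
    (L k).1 0 0 * (q - p) 0 0 + (L k).1 0 1 * (q - p) 0 1 = 0.
  move=> [_ /= p0] [_ /= q0]; move: p0 q0; rewrite !aevalE !mxE => p0 q0.
  by lra.
exists (perp (L i).1); split.
- exact: perp_neq0.
- by move=> p q Fp Fq; apply: key => //; exact: dir Fp Fq.
- move=> p q Fp Fq; apply: key => //.
  have := dir _ _ _ Fp Fq; move: d0 n2j; rewrite /det2.
  move: ((L i).1 0 0) ((L i).1 0 1) ((L j).1 0 0) ((L j).1 0 1) => a b c d.
  move: ((q - p) 0 0) ((q - p) 0 1) => x y d0 n2 e.
  have n20 : c ^+ 2 + d ^+ 2 != 0 by rewrite gt_eqF.
  apply: (mulfI n20); rewrite mulr0.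
  have -> : (c ^+ 2 + d ^+ 2) * (a * x + b * y) =
     (a * c + b * d) * (c * x + d * y) + (d * x - c * y) * (a * d - b * c) by ring.
  by rewrite e d0 !mulr0 addr0.
Qed.

Lemma continuous_aeval (l : affine_fun R) : continuous (aeval l).
Proof.
move=> p; apply: differentiable_continuous.
pose e : expr R 2 := EAdd (EAdd (EMul (ECst (l.1 0 0)) (EVar 0))
  (EMul (ECst (l.1 0 1)) (EVar 1))) (ECst l.2).
have -> : aeval l = eval e by apply/funext => q; rewrite aevalE.
have re : regular_at e p by [].
by have [] := is_diff_eval re.
Qed.

(** Otherwise a ray in direction v stays in Delta, whereas the linear function given by v is bounded
    on a compact set. *)
Lemma label_no_recession (L : label R) (v : 'rV[R]_2) :
  compact Delta -> is_label Delta L -> v != 0 ->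
  exists j, (L j).1 0 0 * v 0 0 + (L j).1 0 1 * v 0 1 < 0.
Proof.
move=> cD [DE _ _] v0; apply: contrapT => nneg.
have ge0 j : 0 <= (L j).1 0 0 * v 0 0 + (L j).1 0 1 * v 0 1.
  by rewrite leNgt; apply/negP => lt0; apply: nneg; exists j.
have [mu0 imu0] := intD; have Dmu0 := interior_subset imu0.
have cf : {within Delta, continuous (aeval ((v, 0) : affine_fun R))}.
  by apply: continuous_subspaceT; exact: continuous_aeval.
have [c Dc cmax] := EVT_max_rV (ex_intro _ _ Dmu0) cD cf.
have v2 := row2_neq0 v0; set n2 := v 0 0 ^+ 2 + v 0 1 ^+ 2 in v2.
(* At this time the linear function exceeds its maximum over Delta by exactly 1. *)
pose t := (aeval ((v, 0) : affine_fun R) c - aeval ((v, 0) : affine_fun R) mu0 + 1) / n2.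
have t0 : 0 <= t.
  apply: divr_ge0; last exact: ltW.
  by apply: addr_ge0 => //; rewrite subr_ge0; apply: cmax; rewrite inE.
have Dt : Delta (mu0 + t *: v).
  move: Dmu0; rewrite DE /= => Dmu0 j; have := Dmu0 j; have := ge0 j.
  rewrite !aevalE !mxE => g0 h0; have := mulr_ge0 t0 g0; lra.
have := cmax _ (mem_set Dt).
have -> : aeval ((v, 0) : affine_fun R) (mu0 + t *: v) =
    aeval ((v, 0) : affine_fun R) mu0 + t * n2.
  by rewrite !aevalE /= !mxE /n2; ring.
rewrite /t divfK ?gt_eqF //; lra.
Qed.

End Labels.

(** * Three sides bounding a triangle *)

Definition pos_rel (R : realType) (u v w : 'rV[R]_2) : Prop :=
  exists a b c, [/\ 0 < a, 0 < b, 0 < c & a *: u + b *: v + c *: w = 0].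

Lemma det2N (R : realType) (u v : 'rV[R]_2) : det2 v u = - det2 u v.
Proof. by rewrite /det2; ring. Qed.

(** Any three plane vectors satisfy det(v,w) u + det(w,u) v + det(u,v) w = 0. *)
Lemma pos_rel_det (R : realType) (u v w : 'rV[R]_2) :
  0 < det2 u v -> 0 < det2 v w -> 0 < det2 w u -> pos_rel u v w.
Proof.
move=> uv vw wu; exists (det2 v w), (det2 w u), (det2 u v); split => //.
by apply: row2P; rewrite !mxE /det2; ring.
Qed.

Lemma pos_relC (R : realType) (u v w : 'rV[R]_2) : pos_rel u v w -> pos_rel u w v.
Proof.
by move=> [a [b [c [a0 b0 d0 e]]]]; exists a, c, b; split => //; rewrite -e addrAC.
Qed.

(* The signs of the determinants form a tournament on four vertices; one in
   which no vertex beats all others contains a 3-cycle. *)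
Lemma exists_pos_rel (R : realType) (n : 'I_4 -> 'rV[R]_2) :
  (forall i j, i != j -> det2 (n i) (n j) != 0) ->
  (forall i, exists j, det2 (n i) (n j) < 0) ->
  [\/ pos_rel (n c0) (n c1) (n c2), pos_rel (n c0) (n c1) (n c3),
      pos_rel (n c0) (n c2) (n c3) | pos_rel (n c1) (n c2) (n c3)].
Proof.
move=> d0 ns.
pose b i j := 0 < det2 (n i) (n j).
have bN i j : i != j -> b j i = ~~ b i j.
  by move=> ij; rewrite /b det2N oppr_gt0 lt_neqAle d0 //= leNgt.
have b0 i : exists2 j, i != j & ~~ b i j.
  have [j lt0] := ns i; exists j; last by rewrite /b -leNgt ltW.
  by apply: contraL lt0 => /eqP <-; rewrite /det2 mulrC subrr ltxx.
have cyc i j k : i != j -> j != k -> k != i -> b i j = b j k -> b j k = b k i ->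
    pos_rel (n i) (n j) (n k).
  move=> ij jk ki; case bij : (b i j) => /esym bjk; rewrite bjk => /esym bki.
    exact: pos_rel_det.
  apply/pos_relC/pos_rel_det.
  - by change (b i k); rewrite bN ?bki.
  - by change (b k j); rewrite bN ?bjk.
  - by change (b j i); rewrite bN ?bij.
have s0 : ~~ [&& b c0 c1, b c0 c2 & b c0 c3].
  by have [j] := b0 c0; elim/ord4_ind: j => // _ /negbTE ->; rewrite ?andbF.
have s1 : ~~ [&& b c1 c0, b c1 c2 & b c1 c3].
  by have [j] := b0 c1; elim/ord4_ind: j => // _ /negbTE ->; rewrite ?andbF.
have s2 : ~~ [&& b c2 c0, b c2 c1 & b c2 c3].
  by have [j] := b0 c2; elim/ord4_ind: j => // _ /negbTE ->; rewrite ?andbF.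
have s3 : ~~ [&& b c3 c0, b c3 c1 & b c3 c2].
  by have [j] := b0 c3; elim/ord4_ind: j => // _ /negbTE ->; rewrite ?andbF.
have := cyc c0 c1 c2 isT isT isT; have := cyc c0 c1 c3 isT isT isT.
have := cyc c0 c2 c3 isT isT isT; have := cyc c1 c2 c3 isT isT isT.
move: s0 s1 s2 s3.
rewrite (bN c0 c1) // (bN c0 c2) // (bN c0 c3) // (bN c1 c2) // (bN c1 c3) // (bN c2 c3) //.
case: (b c0 c1); case: (b c0 c2); case: (b c0 c3); case: (b c1 c2);
  case: (b c1 c3); case: (b c2 c3) => //= _ _ _ _ h4 h3 h2 h1;
  by [apply: Or41; apply: h1 | apply: Or42; apply: h2
     | apply: Or43; apply: h3 | apply: Or44; apply: h4].
Qed.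

Lemma unitmx2 (R : realType) (M : 'M[R]_2) :
  M 0 0 * M 1 1 - M 0 1 * M 1 0 != 0 -> M \in unitmx.
Proof.
set d := _ - _ => d0.
pose N : 'M[R]_2 := \matrix_(i, j) (d^-1 * nth 0 (nth [::]
  [:: [:: M 1 1; - M 0 1]; [:: - M 1 0; M 0 0]] i) j).
have E : M *m N = 1%:M.
  apply/matrixP => i j; rewrite mxE sum_ord2 !mxE.
  by move: i j; elim/ord2_ind; elim/ord2_ind => /=; move: d0; rewrite /d => d0; field.
by have [] := mulmx1_unit E.
Qed.

(* [tangent s M b] is the line s^2 - s mu_1 + mu_2 = 0 in the coordinates
   mu M + b. *)
Definition tangent (R : realType) (s : R) (M : 'M[R]_2) (b : 'rV[R]_2) :
    affine_fun R :=
  ((\row_(i < 2) [:: - s; 1]`_i) *m M^T, s ^+ 2 - s * b 0 0 + b 0 1).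

Lemma tangent1E (R : realType) (s : R) (M : 'M[R]_2) (b : 'rV[R]_2) i :
  (tangent s M b).1 0 i = M i 1 - s * M i 0.
Proof.
by rewrite /= mxE sum_ord2 !mxE /= mul1r addrC mulNr.
Qed.

(** At the point with roots x, y the line of parameter s takes the value (s - x)(s - y), which on
    the quadrilateral is nonpositive for s = y2 and s = x1; hence the two sign changes. *)
Definition tangent_label (R : realType) (y1 y2 x1 x2 : R) (M : 'M[R]_2)
    (b : 'rV[R]_2) : label R :=
  lab4 (tangent y1 M b) (ascale (-1) (tangent y2 M b))
       (ascale (-1) (tangent x1 M b)) (tangent x2 M b).

Definition has_normal_form (R : realType) (Delta : set 'rV[R]_2) : Prop :=
  exists y1 y2 x1 x2 M b, [/\ [/\ y1 < y2, y2 < x1 & x1 < x2], M \in unitmx &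
    is_label Delta (tangent_label y1 y2 x1 x2 M b)].

(** * The parabola touching the four sides *)

Section NormalForm.
Variables (R : realType) (Delta : set 'rV[R]_2) (l0 l1 l2 l3 : affine_fun R).
Hypothesis HL : is_label Delta (lab4 l0 l1 l2 l3).
Variables (p0 p1 p2 s0 s1 s2 : R).
Hypothesis d01 : det2 l0.1 l1.1 != 0.
Hypothesis sum_n : forall i,
  s0 * p0 * l0.1 0 i + s1 * p1 * l1.1 0 i + s2 * p2 * l2.1 0 i = 0.
Hypothesis sum_c : s0 * p0 * l0.2 + s1 * p1 * l1.2 + s2 * p2 * l2.2 = 1.
Hypothesis l3_n : forall i,
  l3.1 0 i = p0 * l0.1 0 i + p1 * l1.1 0 i + p2 * l2.1 0 i.
Hypothesis l3_c : l3.2 = p0 * l0.2 + p1 * l1.2 + p2 * l2.2.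

(* The parabola touching the four lines: its tangent at parameter s is
   sum_j s_j p_j prod_(i != j) (s - s_i) l_j, which is l_j up to a factor at
   s = s_j, the line l3 at s = 0, and the line at infinity at s = oo. *)
Lemma normal_form_of_params :
  p0 < 0 -> 0 < p1 -> 0 < p2 -> s0 < 0 -> 0 < s2 -> s2 < s1 ->
  has_normal_form Delta.
Proof.
move=> p0n p1p p2p s0n s2p s21.
(* The tangent at s expands as s^2 - e s + h, its leading coefficient being the constant function 1.
   So the affine functions e and h are the adapted coordinates mu_1 and mu_2. *)
pose e (f : affine_fun R -> R) := s0 * p0 * (s1 + s2) * f l0
  + s1 * p1 * (s0 + s2) * f l1 + s2 * p2 * (s0 + s1) * f l2.
pose h (f : affine_fun R -> R) := s0 * p0 * (s1 * s2) * f l0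
  + s1 * p1 * (s0 * s2) * f l1 + s2 * p2 * (s0 * s1) * f l2.
pose M : 'M[R]_2 := \matrix_(i, j) [:: e (fun l => l.1 0 i); h (fun l => l.1 0 i)]`_j.
pose b : 'rV[R]_2 := \row_j [:: e snd; h snd]`_j.
pose k0 := s0 * p0 * (s0 - s1) * (s0 - s2).
pose k1 := s1 * p1 * (s1 - s0) * (s1 - s2).
pose k2 := s2 * p2 * (s2 - s0) * (s2 - s1).
have T1 s i : (tangent s M b).1 0 i = s0 * p0 * (s - s1) * (s - s2) * l0.1 0 i
  + s1 * p1 * (s - s0) * (s - s2) * l1.1 0 i
  + s2 * p2 * (s - s0) * (s - s1) * l2.1 0 i.
  rewrite tangent1E !mxE /= /e /h -[LHS]addr0 -(mulr0 (s ^+ 2)) -(sum_n i).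
  by ring.
have T2 s : (tangent s M b).2 = s0 * p0 * (s - s1) * (s - s2) * l0.2
  + s1 * p1 * (s - s0) * (s - s2) * l1.2
  + s2 * p2 * (s - s0) * (s - s1) * l2.2.
  by rewrite /= !mxE /= /e /h -[s ^+ 2]mulr1 -sum_c; ring.
have tE s (l : affine_fun R) : (forall i, (tangent s M b).1 0 i = l.1 0 i) ->
    (tangent s M b).2 = l.2 -> tangent s M b = l.
  case: l => n c /= H1 H2; congr (_, _); last exact: H2.
  by apply: row2P; exact: H1.
have t0 : tangent s0 M b = ascale k0 l0.
  by apply: tE => [i|]; rewrite ?T1 ?T2 ?mxE /k0 /=; rewrite ?mxE; ring.
have t1 : tangent s1 M b = ascale k1 l1.
  by apply: tE => [i|]; rewrite ?T1 ?T2 ?mxE /k1 /=; rewrite ?mxE; ring.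
have t2 : tangent s2 M b = ascale k2 l2.
  by apply: tE => [i|]; rewrite ?T1 ?T2 ?mxE /k2 /=; rewrite ?mxE; ring.
have t3 : tangent 0 M b = ascale (s0 * s1 * s2) l3.
  by apply: tE => [i|]; rewrite ?T1 ?T2 ?mxE /=; rewrite ?mxE ?l3_n ?l3_c; ring.
have k0p : 0 < k0.
  have -> : k0 = (- s0 * - p0) * ((s1 - s0) * (s2 - s0)) by rewrite /k0; ring.
  by rewrite !mulr_gt0; lra.
have k1p : 0 < k1 by rewrite /k1 !mulr_gt0; lra.
have k2n : 0 < - k2.
  have -> : - k2 = s2 * p2 * (s2 - s0) * (s1 - s2) by rewrite /k2; ring.
  by rewrite !mulr_gt0; lra.
have k3n : 0 < - (s0 * s1 * s2).
  have -> : - (s0 * s1 * s2) = - s0 * s1 * s2 by ring.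
  by rewrite !mulr_gt0; lra.
(* By s0 < 0 < s2 < s1, the sides [l0], [l3] belong to y and [l2], [l1] to x. The factors at the two
   middle parameters are the negative ones, as [tangent_label] requires. *)
exists s0, 0, s2, s1, M, b; split; first by split.
  apply: unitmx2; apply/eqP => dM.
  have E0 i : k0 * l0.1 0 i = M i 1 - s0 * M i 0.
    by rewrite -(tangent1E s0 M b) t0 /= mxE.
  have E1 i : k1 * l1.1 0 i = M i 1 - s1 * M i 0.
    by rewrite -(tangent1E s1 M b) t1 /= mxE.
  case/eqP: d01.
  apply: (mulfI (lt0r_neq0 k0p)); apply: (mulfI (lt0r_neq0 k1p)); rewrite !mulr0.
  rewrite /det2; transitivity ((k0 * l0.1 0 0) * (k1 * l1.1 0 1)
    - (k0 * l0.1 0 1) * (k1 * l1.1 0 0)); first by ring.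
  by rewrite !E0 !E1 -(mulr0 (s1 - s0)) -dM; ring.
pose k (j : 'I_4) := nth 0 [:: k0; - (s0 * s1 * s2); - k2; k1] j.
apply: (@is_label_ascale _ _ (lab4 l0 l3 l2 l1) _ k).
- by elim/ord4_ind.
- by elim/ord4_ind; rewrite /tangent_label /lab4 /k /= ?t0 ?t1 ?t2 ?t3 ?ascaleA ?mulN1r.
- exact/is_label_swap23/is_label_swap12/is_label_swap23.
Qed.
End NormalForm.

(** * The fourth side relative to a triangle *)

Section Triple.
Variables (R : realType) (Delta : set 'rV[R]_2).

(** The functions c_j l_j are the barycentric coordinates of the triangle bounded by l0, l1, l2, and
    l3 takes the value p_j / c_j at the vertex opposite side j. *)
Record triple (l0 l1 l2 l3 : affine_fun R) (c0 c1 c2 p0 p1 p2 : R) : Prop := Triple {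
  tr_label : is_label Delta (lab4 l0 l1 l2 l3);
  tr_det : forall i j, i != j ->
    det2 (lab4 l0 l1 l2 l3 i).1 (lab4 l0 l1 l2 l3 j).1 != 0;
  tr_gt0 : [/\ 0 < c0, 0 < c1 & 0 < c2];
  tr_n : forall i, c0 * l0.1 0 i + c1 * l1.1 0 i + c2 * l2.1 0 i = 0;
  tr_c : c0 * l0.2 + c1 * l1.2 + c2 * l2.2 = 1;
  tr_l3n : forall i, l3.1 0 i = p0 * l0.1 0 i + p1 * l1.1 0 i + p2 * l2.1 0 i;
  tr_l3c : l3.2 = p0 * l0.2 + p1 * l1.2 + p2 * l2.2 }.

Lemma triple_swap01 l0 l1 l2 l3 c0 c1 c2 p0 p1 p2 :
  triple l0 l1 l2 l3 c0 c1 c2 p0 p1 p2 -> triple l1 l0 l2 l3 c1 c0 c2 p1 p0 p2.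
Proof.
case=> HL HD [? ? ?] Hn Hc Hn3 Hc3; split => //.
- exact: is_label_swap01.
- pose s := fun j : 'I_4 => nth Defs.c3 [:: Defs.c1; Defs.c0; Defs.c2; Defs.c3] j.
  have sE j : lab4 l1 l0 l2 l3 j = lab4 l0 l1 l2 l3 (s j) by elim/ord4_ind: j.
  move=> i j ij; rewrite !sE; apply: HD; move: ij.
  by elim/ord4_ind: i; elim/ord4_ind: j.
- by move=> i; rewrite -[RHS](Hn i); ring.
- by rewrite -[RHS]Hc; ring.
- by move=> i; rewrite Hn3; ring.
- by rewrite Hc3; ring.
Qed.

Lemma triple_swap12 l0 l1 l2 l3 c0 c1 c2 p0 p1 p2 :
  triple l0 l1 l2 l3 c0 c1 c2 p0 p1 p2 -> triple l0 l2 l1 l3 c0 c2 c1 p0 p2 p1.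
Proof.
case=> HL HD [? ? ?] Hn Hc Hn3 Hc3; split => //.
- exact: is_label_swap12.
- pose s := fun j : 'I_4 => nth Defs.c3 [:: Defs.c0; Defs.c2; Defs.c1; Defs.c3] j.
  have sE j : lab4 l0 l2 l1 l3 j = lab4 l0 l1 l2 l3 (s j) by elim/ord4_ind: j.
  move=> i j ij; rewrite !sE; apply: HD; move: ij.
  by elim/ord4_ind: i; elim/ord4_ind: j.
- by move=> i; rewrite -[RHS](Hn i); ring.
- by rewrite -[RHS]Hc; ring.
- by move=> i; rewrite Hn3; ring.
- by rewrite Hc3; ring.
Qed.

Section TripleFacts.
Variables (l0 l1 l2 l3 : affine_fun R) (c0 c1 c2 p0 p1 p2 : R).
Hypothesis T : triple l0 l1 l2 l3 c0 c1 c2 p0 p1 p2.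

Lemma triple_aeval mu :
  aeval l3 mu = p0 * aeval l0 mu + p1 * aeval l1 mu + p2 * aeval l2 mu.
Proof. by rewrite !aevalE !(tr_l3n T) (tr_l3c T); ring. Qed.

Lemma triple_ge0 mu : Delta mu ->
  [/\ 0 <= aeval l0 mu, 0 <= aeval l1 mu, 0 <= aeval l2 mu & 0 <= aeval l3 mu].
Proof.
have [DE _ _] := tr_label T; rewrite DE => /= H.
by split; [exact: (H Defs.c0)|exact: (H Defs.c1)|exact: (H Defs.c2)|exact: (H Defs.c3)].
Qed.

(** Equal values of [l3] at the two vertices on the side [l2] would make these sides parallel. *)
Lemma triple_neq : p0 * c1 != p1 * c0.
Proof.
apply/eqP => e; have [c0p _ _] := tr_gt0 T.
have n3 i : c0 * l3.1 0 i = (c0 * p2 - p0 * c2) * l2.1 0 i.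
  rewrite (tr_l3n T) -[RHS]addr0 -(mulr0 p0) -(tr_n T i).
  have -> : p1 = p0 * c1 / c0 by rewrite e mulfK // gt_eqF.
  by field; rewrite gt_eqF.
have := tr_det T (isT : Defs.c3 != Defs.c2) => /eqP; apply.
apply: (mulfI (lt0r_neq0 c0p)); rewrite mulr0 /det2 /=.
by rewrite mulrBr !mulrA !n3; ring.
Qed.

(** On the face of [l0] the function l3 = p1 l1 + p2 l2 is nonnegative, so both terms vanish there.
    A nonzero coefficient would shrink the face to a point; if both are zero, [l3] is parallel to
    [l0]. *)
Lemma triple_not_le0 : ~ (p1 <= 0 /\ p2 <= 0).
Proof.
move=> [p1n p2n].
have [P [Q [FP FQ /eqP PQ]]] := face_two_points Defs.c0 (tr_label T).
have van mu : face Delta l0 mu ->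
    aeval l0 mu = 0 /\ (p1 * aeval l1 mu = 0 /\ p2 * aeval l2 mu = 0).
  move=> [Dmu /= e0]; have [_ g1 g2] := triple_ge0 Dmu; rewrite triple_aeval e0.
  have := mulr_le0_ge0 p1n g1; have := mulr_le0_ge0 p2n g2.
  by split => //; lra.
have [P0 [P1 P2]] := van _ FP; have [Q0 [Q1 Q2]] := van _ FQ.
have [p10|p10] := eqVneq p1 0; last first.
  apply: PQ; apply: (det2_eq (tr_det T (isT : Defs.c0 != Defs.c1))) => /=.
    by rewrite P0 Q0.
  by apply: (mulfI p10); rewrite P1 Q1.
have [p20|p20] := eqVneq p2 0; last first.
  apply: PQ; apply: (det2_eq (tr_det T (isT : Defs.c0 != Defs.c2))) => /=.
    by rewrite P0 Q0.
  by apply: (mulfI p20); rewrite P2 Q2.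
have := tr_det T (isT : Defs.c3 != Defs.c0) => /eqP; apply.
by rewrite /det2 /= !(tr_l3n T) p10 p20; ring.
Qed.

(** The parameters s_j = c_j / p_j turn the relation among the c_j into the one required of the
    products s_j p_j; the last hypothesis is s_2 < s_1. *)
Lemma triple_normal_form :
  p0 < 0 -> 0 < p1 -> 0 < p2 -> p1 * c2 < p2 * c1 -> has_normal_form Delta.
Proof.
move=> p0n p1p p2p lt12; have [c0p c1p c2p] := tr_gt0 T.
have E (c p : R) : p != 0 -> c / p * p = c by move=> p0'; rewrite divfK.
have E0 : c0 / p0 * p0 = c0 by rewrite E // lt_eqF.
have E1 : c1 / p1 * p1 = c1 by rewrite E // gt_eqF.
have E2 : c2 / p2 * p2 = c2 by rewrite E // gt_eqF.
apply: (@normal_form_of_params _ _ l0 l1 l2 l3 (tr_label T) p0 p1 p2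
  (c0 / p0) (c1 / p1) (c2 / p2)) => //.
- exact: (tr_det T (isT : Defs.c0 != Defs.c1)).
- by move=> i; rewrite E0 E1 E2; exact: (tr_n T).
- by rewrite E0 E1 E2; exact: (tr_c T).
- exact: (tr_l3n T).
- exact: (tr_l3c T).
- by rewrite pmulr_rlt0 // invr_lt0.
- by rewrite divr_gt0.
- by rewrite ltr_pdivrMr // mulrAC ltr_pdivlMr // mulrC [ltRHS]mulrC.
Qed.

End TripleFacts.

(** On the face of [l3] every p_j l_j vanishes. By [triple_neq] at most one p_j is zero, so two of
    the l_j vanish and the face is a point. *)
Lemma triple_not_ge0 l0 l1 l2 l3 c0 c1 c2 p0 p1 p2 :
  triple l0 l1 l2 l3 c0 c1 c2 p0 p1 p2 -> ~ [/\ 0 <= p0, 0 <= p1 & 0 <= p2].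
Proof.
move=> T [p0p p1p p2p].
have [P [Q [FP FQ /eqP PQ]]] := face_two_points Defs.c3 (tr_label T).
have van mu : face Delta l3 mu ->
    [/\ p0 * aeval l0 mu = 0, p1 * aeval l1 mu = 0 & p2 * aeval l2 mu = 0].
  move=> [Dmu /= e0]; have [g0 g1 g2 _] := triple_ge0 T Dmu.
  move: e0; rewrite (triple_aeval T).
  have := mulr_ge0 p0p g0; have := mulr_ge0 p1p g1; have := mulr_ge0 p2p g2.
  by split; lra.
have [P0 P1 P2] := van _ FP; have [Q0 Q1 Q2] := van _ FQ.
have N01 := triple_neq T; have N02 := triple_neq (triple_swap12 T).
have N12 := triple_neq (triple_swap12 (triple_swap01 T)).
have eqv (p : R) l : p != 0 -> p * aeval l P = 0 -> p * aeval l Q = 0 ->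
    aeval l P = aeval l Q by move=> p0' lP lQ; apply: (mulfI p0'); rewrite lP lQ.
have [p00|p00] := eqVneq p0 0; have [p10|p10] := eqVneq p1 0;
  have [p20|p20] := eqVneq p2 0;
  try (by move: N01 N02 N12; rewrite ?p00 ?p10 ?p20 !mul0r ?eqxx);
  apply: PQ.
- by apply: (det2_eq (tr_det T (isT : Defs.c1 != Defs.c2))) => /=;
    [exact: eqv p10 P1 Q1|exact: eqv p20 P2 Q2].
- by apply: (det2_eq (tr_det T (isT : Defs.c0 != Defs.c2))) => /=;
    [exact: eqv p00 P0 Q0|exact: eqv p20 P2 Q2].
- by apply: (det2_eq (tr_det T (isT : Defs.c0 != Defs.c1))) => /=;
    [exact: eqv p00 P0 Q0|exact: eqv p10 P1 Q1].
- by apply: (det2_eq (tr_det T (isT : Defs.c0 != Defs.c1))) => /=;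
    [exact: eqv p00 P0 Q0|exact: eqv p10 P1 Q1].
Qed.

(** Some p_j is negative and then the other two are positive. Renumbering the triangle makes it p_0
    and, if necessary, exchanges the two positive parameters. *)
Lemma triple_has_normal_form l0 l1 l2 l3 c0 c1 c2 p0 p1 p2 :
  triple l0 l1 l2 l3 c0 c1 c2 p0 p1 p2 -> has_normal_form Delta.
Proof.
have main m0 m1 m2 d0 d1 d2 q0 q1 q2 : triple m0 m1 m2 l3 d0 d1 d2 q0 q1 q2 ->
    q0 < 0 -> has_normal_form Delta.
  move=> T q0n.
  have q1p : 0 < q1.
    rewrite ltNge; apply/negP => q1n.
    apply: (triple_not_le0 (triple_swap12 (triple_swap01 (triple_swap12 T)))).
    by split => //; exact: ltW.
  have q2p : 0 < q2.
    rewrite ltNge; apply/negP => q2n.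
    apply: (triple_not_le0 (triple_swap01 T)).
    by split => //; exact: ltW.
  have := triple_neq (triple_swap12 (triple_swap01 T)).
  have [lt12 _|lt21 _|//] := ltgtP (q1 * d2) (q2 * d1).
  - exact: (triple_normal_form T).
  - exact: (triple_normal_form (triple_swap12 T)).
move=> T.
have [/(main _ _ _ _ _ _ _ _ _ T) //|p0p] := ltP p0 0.
have [/(main _ _ _ _ _ _ _ _ _ (triple_swap01 T)) //|p1p] := ltP p1 0.
have [/(main _ _ _ _ _ _ _ _ _ (triple_swap01 (triple_swap12 T))) //|p2p] := ltP p2 0.
by case: (triple_not_ge0 T).
Qed.

(** The positive relation makes the combination of l0, l1, l2 a constant [C]. It is positive, since
    for C = 0 both l0 and l1 would vanish on Delta; dividing by it gives barycentric coordinates. *)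
Lemma triple_of_pos_rel l0 l1 l2 l3 :
  is_label Delta (lab4 l0 l1 l2 l3) ->
  (forall i j, i != j ->
    det2 (lab4 l0 l1 l2 l3 i).1 (lab4 l0 l1 l2 l3 j).1 != 0) ->
  pos_rel l0.1 l1.1 l2.1 -> has_normal_form Delta.
Proof.
move=> HL HD [c0 [c1 [c2 [c0p c1p c2p rel]]]].
have rel_n i : c0 * l0.1 0 i + c1 * l1.1 0 i + c2 * l2.1 0 i = 0.
  by have /rowP/(_ i) := rel; rewrite !mxE.
pose C := c0 * l0.2 + c1 * l1.2 + c2 * l2.2.
have CE mu : c0 * aeval l0 mu + c1 * aeval l1 mu + c2 * aeval l2 mu = C.
  rewrite !aevalE /C -[RHS]addr0 -(mul0r (mu 0 0)) -(rel_n 0).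
  by rewrite -[RHS]addr0 -(mul0r (mu 0 1)) -(rel_n 1); ring.
have ge0 mu : Delta mu -> [/\ 0 <= aeval l0 mu, 0 <= aeval l1 mu & 0 <= aeval l2 mu].
  have [DE _ _] := HL; rewrite DE => /= H.
  by split; [exact: (H Defs.c0)|exact: (H Defs.c1)|exact: (H Defs.c2)].
have [P [Q [[DP _] [DQ _] /eqP PQ]]] := face_two_points Defs.c0 HL.
have Cp : 0 < C.
  rewrite lt_neqAle; apply/andP; split; last first.
    rewrite -(CE P); have [g0 g1 g2] := ge0 _ DP.
    by rewrite !addr_ge0 // mulr_ge0 // ltW.
  rewrite eq_sym; apply/eqP => C0.
  have van mu : Delta mu -> aeval l0 mu = 0 /\ aeval l1 mu = 0.
    move=> /ge0[g0 g1 g2]; have := CE mu; rewrite C0.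
    have := mulr_ge0 (ltW c0p) g0; have := mulr_ge0 (ltW c1p) g1.
    have := mulr_ge0 (ltW c2p) g2 => h2 h1 h0 e.
    split; [apply: (mulfI (lt0r_neq0 c0p))|apply: (mulfI (lt0r_neq0 c1p))];
      rewrite mulr0; lra.
  have [P0 P1] := van _ DP; have [Q0 Q1] := van _ DQ.
  by apply: PQ; apply: (det2_eq (HD Defs.c0 Defs.c1 isT)) => /=; rewrite ?P0 ?P1.
have C0 : C != 0 by rewrite gt_eqF.
have d01 : det2 l0.1 l1.1 != 0 by exact: (HD Defs.c0 Defs.c1 isT).
pose u := det2 l3.1 l1.1 / det2 l0.1 l1.1.
pose v := det2 l0.1 l3.1 / det2 l0.1 l1.1.
have uvE i : l3.1 0 i = u * l0.1 0 i + v * l1.1 0 i.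
  suff [] : l3.1 0 0 = u * l0.1 0 0 + v * l1.1 0 0 /\
            l3.1 0 1 = u * l0.1 0 1 + v * l1.1 0 1.
    by move=> e0 e1; elim/ord2_ind: i.
  rewrite /u /v; move: d01; rewrite /det2 => d01.
  by split; field.
(* With u and v matching the differentials, l3 - u l0 - v l1 is constant, and a multiple of the
   relation with value [C] absorbs it. *)
pose w := (l3.2 - u * l0.2 - v * l1.2) / C.
apply: (@triple_has_normal_form l0 l1 l2 l3 (c0 / C) (c1 / C) (c2 / C)
  (u + w * c0) (v + w * c1) (w * c2)); split => //.
- by rewrite !divr_gt0.
- move=> i; transitivity (C^-1 * (c0 * l0.1 0 i + c1 * l1.1 0 i + c2 * l2.1 0 i)).
    by move: (C^-1) => iC; ring.
  by rewrite rel_n mulr0.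
- by rewrite -(divff C0); move: (C^-1) => iC; rewrite /C; ring.
- by move=> i; rewrite uvE -[LHS]addr0 -(mulr0 w) -(rel_n i); ring.
- have wC : w * C = l3.2 - u * l0.2 - v * l1.2 by rewrite /w divfK.
  transitivity (w * C + u * l0.2 + v * l1.2); first by rewrite wC; ring.
  by rewrite /C; move: w {wC} => w; ring.
Qed.

End Triple.

Lemma quadrilateral_normal_form (R : realType) (Delta : set 'rV[R]_2) :
  convex_quadrilateral Delta ->
  (forall F G : set 'rV[R]_2, is_facet Delta F -> is_facet Delta G ->
     F <> G -> ~ parallel F G) ->
  has_normal_form Delta.
Proof.
move=> [cD intD [L HL]] npar.
have HD l0 l1 l2 l3 : is_label Delta (lab4 l0 l1 l2 l3) -> forall i j, i != j ->
    det2 (lab4 l0 l1 l2 l3 i).1 (lab4 l0 l1 l2 l3 j).1 != 0.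
  by move=> H i j ij; exact: (label_det2 intD npar H ij).
have H := HL; rewrite (lab4_eta L) in H.
have [] := @exists_pos_rel _ (fun j => (L j).1).
- by move=> i j ij; exact: (label_det2 intD npar HL ij).
(* Pairing a normal with [perp] of another gives their determinant, so the absence of recession
   directions is the second hypothesis of [exists_pos_rel]. *)
- move=> i; have v0 := perp_neq0 (label_neq0 intD i HL).
  have [j lt0] := label_no_recession intD cD HL v0.
  exists j; move: lt0; rewrite !mxE /= /det2; congr (_ < _); ring.
- exact: (triple_of_pos_rel H (HD _ _ _ _ H)).
- have H' := is_label_swap23 H.
  exact: (triple_of_pos_rel H' (HD _ _ _ _ H')).
- have H' := is_label_swap23 (is_label_swap12 H).
  exact: (triple_of_pos_rel H' (HD _ _ _ _ H')).
- have H' := is_label_swap23 (is_label_swap12 (is_label_swap01 H)).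
  exact: (triple_of_pos_rel H' (HD _ _ _ _ H')).
Qed.

(** * The orthotoric metric with quadratic profile functions *)

Definition parabola (R : realType) (k r1 r2 : R) : R -> R :=
  fun x => k * (x - r1) * (r2 - x).

Section Parabola.
Variables (R : realType) (k r1 r2 : R).

Definition parabola_poly : {poly R} :=
  (- k) *: 'X^2 + (k * (r1 + r2)) *: 'X - (k * r1 * r2)%:P.

Lemma parabolaE : parabola k r1 r2 = horner parabola_poly.
Proof. by apply/funext => x; rewrite /parabola_poly !hornerE /parabola /=; ring. Qed.

Lemma derive1n_parabola n :
  (parabola k r1 r2)^`(n)%classic = horner (iter n (@deriv R) parabola_poly).
Proof.
elim: n => [|n IH]; first by rewrite derive1n0 parabolaE.
by rewrite derive1nS IH -derivE.
Qed.

Lemma derivable_parabola n x : derivable (parabola k r1 r2)^`(n)%classic x 1.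
Proof. by rewrite derive1n_parabola; exact: derivable_horner. Qed.

Lemma derive1_parabola x :
  (parabola k r1 r2)^`()%classic x = k * (r1 + r2 - 2 * x).
Proof.
rewrite -derive1n1 derive1n_parabola /= /parabola_poly.
by rewrite derivB derivD !derivZ derivXn derivX derivC !hornerE /= -mulr_natl; ring.
Qed.

Lemma derive2_parabola : (parabola k r1 r2)^`()^`()%classic = cst (- 2 * k).
Proof.
rewrite (_ : (parabola k r1 r2)^`()^`()%classic = (parabola k r1 r2)^`(2)%classic) //.
apply/funext => x; rewrite derive1n_parabola /= /parabola_poly.
rewrite !(derivB, derivD, derivZ, derivXn, derivX, derivC, derivMn) !hornerE /=.
by ring.
Qed.

Lemma parabola_gt0 x : 0 < k -> r1 < x < r2 -> 0 < parabola k r1 r2 x.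
Proof. by move=> k0 /andP[? ?]; rewrite /parabola !mulr_gt0 // subr_gt0. Qed.

End Parabola.

Lemma omoment0 (R : realType) (x y : R) : omoment x y 0 0 = x + y.
Proof. by rewrite mxE. Qed.

Lemma omoment1 (R : realType) (x y : R) : omoment x y 0 1 = x * y.
Proof. by rewrite mxE. Qed.

Lemma aeval_tangent (R : realType) (s : R) (M : 'M[R]_2) (b mu : 'rV[R]_2) :
  aeval (tangent s M b) mu = s ^+ 2 - s * (mu *m M + b) 0 0 + (mu *m M + b) 0 1.
Proof. by rewrite aevalE !tangent1E !mxE !sum_ord2 /=; ring. Qed.

Lemma aeval_tangent_omoment (R : realType) (s x y : R) (M : 'M[R]_2) (b mu : 'rV[R]_2) :
  mu *m M + b = omoment x y -> aeval (tangent s M b) mu = (s - x) * (s - y).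
Proof. by move=> e; rewrite aeval_tangent e omoment0 omoment1; ring. Qed.

Section QuadraticMetric.
Variables (R : realType) (y1 y2 x1 x2 : R).
Hypothesis order : [/\ y1 < y2, y2 < x1 & x1 < x2].
Variables (alpha beta : R).
Hypotheses (alpha0 : 0 < alpha) (beta0 : 0 < beta).

Definition quad_orthotoric : orthotoric R := Orthotoric order
  (fun n x _ => @derivable_parabola R alpha x1 x2 n x)
  (fun n y _ => @derivable_parabola R beta y1 y2 n y)
  (fun x => @parabola_gt0 R alpha x1 x2 x alpha0)
  (fun y => @parabola_gt0 R beta y1 y2 y beta0).

Lemma quad_scalar_curvature_gt0 p : odom quad_orthotoric p ->
  0 < scalar_curvature (omet quad_orthotoric) p.
Proof.
move=> hp; rewrite (@scalar_curvature_quadratic _ _ alpha beta) //=;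
  try exact: derive2_parabola.
have [_ _ D0] := odom_gt0 hp.
by rewrite mulN1r divr_gt0 // mulr_gt0 // addr_gt0.
Qed.

(** Minus a quarter of the discriminant of A(s) + B(s), both profiles being read as polynomials in
    one variable s. *)
Definition flux_sq : R :=
  (alpha + beta) * (alpha * (x1 * x2) + beta * (y1 * y2))
  - (alpha * (x1 + x2) + beta * (y1 + y2)) ^+ 2 / 4.

(** Only theta /\ theta enters the equation; leaving theta free covers both the multiple of the
    anti-self-dual form and theta = 0. *)
Lemma quad_curvature_equation (theta : 'rV[R]_4 -> 'M[R]_4) :
  (forall p, odom quad_orthotoric p -> wedge22 (theta p) (theta p) =
     2 * flux_sq / (p 0 c0 - p 0 c1) ^+ 3) ->
  curvature_equation quad_orthotoric theta.
Proof.
move=> thetaE g w p hp; rewrite /g /w; have [_ _ D0] := odom_neq0 hp.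
rewrite (@ddc_scalar_curvature _ _ alpha beta) //=; try exact: derive2_parabola.
rewrite thetaE // wedge22_ricci_form // /ricci_weight1 /ricci_weight2 /=.
rewrite !derive2_parabola !derive1_parabola /parabola /flux_sq /cst.
by move: (p 0 c0) (p 0 c1) D0 => x y D0; field; rewrite ?D0.
Qed.

Lemma quad_curvature_equation0 : flux_sq = 0 ->
  curvature_equation quad_orthotoric (fun=> 0).
Proof.
move=> f0; apply: quad_curvature_equation => p hp.
by rewrite f0 /wedge22 !mxE; ring.
Qed.

Lemma quad_curvature_equation_flux : 0 <= flux_sq ->
  exists theta, closed_primitive_11 quad_orthotoric theta /\
    curvature_equation quad_orthotoric theta.
Proof.
move=> f0; exists (asd_form (Num.sqrt flux_sq)); split.
  exact: asd_form_closed_primitive_11.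
apply: quad_curvature_equation => p hp.
by rewrite (wedge22_asd_form _ hp) sqr_sqrtr.
Qed.

(** * Gram matrix of the Killing fields and boundary conditions *)

Section Boundary.
Variables (M : 'M[R]_2) (b : 'rV[R]_2).
Hypothesis uM : M \in unitmx.

(** The signs at y2 and x1 put both between the roots; then y1 < x and y < x2, and the signs at y1
    and x2 decide the rest. *)
Lemma roots_range (x y : R) : y < x ->
  0 <= (y1 - x) * (y1 - y) -> (y2 - x) * (y2 - y) <= 0 ->
  (x1 - x) * (x1 - y) <= 0 -> 0 <= (x2 - x) * (x2 - y) ->
  x1 <= x <= x2 /\ y1 <= y <= y2.
Proof.
move=> yx; have [y12 y2x1 x12] := order.
have key s : (s - x) * (s - y) <= 0 -> y <= s <= x.
  move=> h; rewrite leNgt [s <= x]leNgt -negb_or; apply/negP => /orP[lt|lt].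
    have : 0 < (x - s) * (y - s) by rewrite mulr_gt0 // subr_gt0 //; lra.
    lra.
  have : 0 < (s - x) * (s - y) by rewrite mulr_gt0 // subr_gt0 //; lra.
  lra.
move=> h1 /key/andP[yy2 y2x] /key/andP[yx1 x1x] h4.
have yy1 : y1 <= y.
  rewrite leNgt; apply/negP => lt.
  have : 0 < (x - y1) * (y1 - y) by rewrite mulr_gt0 // subr_gt0 //; lra.
  lra.
have xx2 : x <= x2.
  rewrite leNgt; apply/negP => lt.
  have : 0 < (x - x2) * (x2 - y) by rewrite mulr_gt0 // subr_gt0 //; lra.
  lra.
by rewrite x1x xx2 yy1 yy2.
Qed.

Variable Delta : set 'rV[R]_2.
Hypothesis HL : is_label Delta (tangent_label y1 y2 x1 x2 M b).

Lemma Delta_roots mu : Delta mu -> exists x y,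
  [/\ x1 <= x <= x2, y1 <= y <= y2 & mu *m M + b = omoment x y].
Proof.
have [-> _ _] := HL => /= H.
have := H c0; have := H c1; have := H c2; have := H c3.
rewrite /tangent_label /lab4 /= !aeval_ascale !aeval_tangent !mulN1r !oppr_ge0.
set m0 := (mu *m M + b) 0 0; set m1 := (mu *m M + b) 0 1 => hx2 hx1 hy2 hy1.
have [y12 y2x1 x12] := order.
(* With q(s) = s^2 - m0 s + m1, the discriminant is (m0 - 2 s)^2 - 4 q(s), and q is nonpositive at
   y2 and x1. A double root would have to equal both. *)
have disc : 0 < m0 ^+ 2 - 4 * m1.
  rewrite lt_neqAle; apply/andP; split; last first.
    have := sqr_ge0 (m0 - 2 * y2); lra.
  rewrite eq_sym; apply/eqP => d0.
  have e1 : (m0 - 2 * y2) ^+ 2 = 0.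
    by apply/eqP; rewrite eq_le sqr_ge0 andbT; lra.
  have e2 : (m0 - 2 * x1) ^+ 2 = 0.
    by apply/eqP; rewrite eq_le sqr_ge0 andbT; lra.
  move/eqP: e1; move/eqP: e2; rewrite !sqrf_eq0 => /eqP e1 /eqP e2; lra.
have r0 : 0 < Num.sqrt (m0 ^+ 2 - 4 * m1) by rewrite sqrtr_gt0.
have rE := sqr_sqrtr (ltW disc); set r := Num.sqrt _ in r0 rE.
pose x := (m0 + r) / 2; pose y := (m0 - r) / 2.
have xy : x * y = m1.
  have -> : x * y = (m0 ^+ 2 - r ^+ 2) / 4 by rewrite /x /y; field.
  by rewrite rE; field.
have xpy : x + y = m0 by rewrite /x /y; field.
have qE s : s ^+ 2 - s * m0 + m1 = (s - x) * (s - y) by rewrite -xy -xpy; ring.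
rewrite !qE in hx2 hx1 hy2 hy1.
have yx : y < x by rewrite /x /y; lra.
have [xr yr] := roots_range yx hy1 hy2 hx1 hx2.
exists x, y; split => //.
by apply: row2P; rewrite ?omoment0 ?omoment1.
Qed.

Lemma roots_Delta x y mu : x1 <= x <= x2 -> y1 <= y <= y2 ->
  mu *m M + b = omoment x y -> Delta mu.
Proof.
move=> /andP[h1 h2] /andP[h3 h4] e; have [y12 y2x1 x12] := order.
have [-> _ _] := HL; elim/ord4_ind;
  rewrite /tangent_label /lab4 /= ?aeval_ascale (aeval_tangent_omoment _ e).
- by rewrite mulr_le0 //; lra.
- by rewrite mulN1r oppr_ge0 mulr_le0_ge0 //; lra.
- by rewrite mulN1r oppr_ge0 mulr_le0_ge0 //; lra.
- by rewrite mulr_ge0 //; lra.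
Qed.

Lemma quad_affine_identification :
  affine_identification Delta quad_orthotoric M b.
Proof.
split => //; apply/seteqP; split => [_ [mu Dmu <-]|_ [x [y [xr yr ->]]]].
  by have [x [y [xr yr e]]] := Delta_roots Dmu; exists x, y.
exists ((omoment x y - b) *m invmx M); last by rewrite mulmxKV // subrK.
by apply: (roots_Delta xr yr); rewrite mulmxKV // subrK.
Qed.

Definition moment_expr (j : 'I_2) : expr R 2 :=
  EAdd (EAdd (EMul (ECst (M 0 j)) (EVar 0)) (EMul (ECst (M 1 j)) (EVar 1)))
    (ECst (b 0 j)).

Definition disc_expr : expr R 2 :=
  ESub (EMul (moment_expr 0) (moment_expr 0)) (EMul (ECst 4) (moment_expr 1)).

Definition gap_expr : expr R 2 := ESqrt disc_expr.

Definition x_expr : expr R 2 := EMul (ECst 2^-1) (EAdd (moment_expr 0) gap_expr).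
Definition y_expr : expr R 2 := EMul (ECst 2^-1) (ESub (moment_expr 0) gap_expr).

Definition parabola_expr (k r1 r2 : R) (e : expr R 2) : expr R 2 :=
  EMul (EMul (ECst k) (ESub e (ECst r1))) (ESub (ECst r2) e).

Definition A_expr := parabola_expr alpha x1 x2 x_expr.
Definition B_expr := parabola_expr beta y1 y2 y_expr.

(* The value at the covectors u, v of the Gram matrix of the fields d/dt'. *)
Definition gram_expr (u v : 'rV[R]_2) : expr R 2 :=
  let lin u e := EAdd (ECst (u 0 0)) (EMul (ECst (u 0 1)) e) in
  EDiv (EAdd (EMul A_expr (EMul (lin u y_expr) (lin v y_expr)))
             (EMul B_expr (EMul (lin u x_expr) (lin v x_expr)))) gap_expr.

Definition quad_gram (mu : 'rV[R]_2) : 'M[R]_2 :=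
  \matrix_(i, j) eval (gram_expr (row i (invmx M)^T) (row j (invmx M)^T)) mu.

(** The outside of the parabola, where two distinct tangents pass through each point. It is an open
    neighbourhood of Delta on which the roots x, y are smooth. *)
Definition disc_pos : set 'rV[R]_2 := [set mu | 0 < eval disc_expr mu].

Lemma eval_moment j mu : eval (moment_expr j) mu = (mu *m M + b) 0 j.
Proof. by rewrite !mxE sum_ord2 /=; ring. Qed.

Lemma open_disc_pos : open disc_pos.
Proof.
have -> : disc_pos = eval disc_expr @^-1` `]0, +oo[.
  by apply/seteqP; split => mu /=; rewrite in_itv /= andbT.
apply: open_comp => [mu _|]; last exact: interval_open.
apply: differentiable_continuous.
have re : regular_at disc_expr mu by [].
by have [] := is_diff_eval re.
Qed.

Lemma regular_gram u v mu : disc_pos mu -> regular_at (gram_expr u v) mu.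
Proof.
move=> d0; have s0 : eval gap_expr mu != 0 by rewrite gt_eqF // sqrtr_gt0.
by move: d0 s0; rewrite /disc_pos /= => d0 s0; repeat split.
Qed.

Lemma eval_roots x y mu : y < x -> mu *m M + b = omoment x y ->
  [/\ disc_pos mu, eval gap_expr mu = x - y, eval x_expr mu = x & eval y_expr mu = y].
Proof.
move=> yx e.
have dE : eval disc_expr mu = (x - y) ^+ 2.
  change (eval (moment_expr 0) mu * eval (moment_expr 0) mu
    + -1 * (4 * eval (moment_expr 1) mu) = (x - y) ^+ 2).
  by rewrite !eval_moment e omoment0 omoment1; ring.
have gE : eval gap_expr mu = x - y.
  change (Num.sqrt (eval disc_expr mu) = x - y).
  by rewrite dE sqrtr_sqr ger0_norm // subr_ge0 ltW.
have mE : eval (moment_expr 0) mu = x + y by rewrite eval_moment e omoment0.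
split => //.
- by rewrite /disc_pos /mkset dE exprn_gt0 // subr_gt0.
- change (2^-1 * (eval (moment_expr 0) mu + eval gap_expr mu) = x).
  by rewrite mE gE; field.
- change (2^-1 * (eval (moment_expr 0) mu + -1 * eval gap_expr mu) = y).
  by rewrite mE gE; field.
Qed.

Lemma eval_gram u v x y mu : y < x -> mu *m M + b = omoment x y ->
  eval (gram_expr u v) mu =
  (parabola alpha x1 x2 x * ((u 0 0 + u 0 1 * y) * (v 0 0 + v 0 1 * y))
   + parabola beta y1 y2 y * ((u 0 0 + u 0 1 * x) * (v 0 0 + v 0 1 * x))) / (x - y).
Proof.
move=> yx e; have [_ gE xE yE] := eval_roots yx e.
rewrite /gram_expr /A_expr /B_expr /parabola_expr /EDiv /ESub.
by move: xE yE gE; move: x_expr y_expr gap_expr => xe ye ge /= -> -> ->;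
  rewrite !mulN1r.
Qed.

Local Notation N := (invmx M)^T.

Lemma bil_quad_gram mu u v :
  bil (quad_gram mu) u v = eval (gram_expr (u *m N) (v *m N)) mu.
Proof.
rewrite /bil /quad_gram mxE !sum_ord2 !mxE !sum_ord2 !mxE.
rewrite /gram_expr /EDiv; move: A_expr B_expr x_expr y_expr gap_expr => Ae Be xe ye ge.
by rewrite /= !mxE !sum_ord2 !mxE; ring.
Qed.

Lemma killing0 (i : 'I_2) (j : 'I_4) : (j < 2)%N -> killing M i j = 0.
Proof.
move=> j2; rewrite /killing mxE; case: splitP => [k _|k jk]; first by rewrite mxE.
by move: j2; rewrite jk.
Qed.

Lemma killing2 (i : 'I_2) : killing M i c2 = N i 0.
Proof.
have -> : c2 = rshift 2 (0 : 'I_2) by exact: val_inj.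
exact: row_mxEr.
Qed.

Lemma killing3 (i : 'I_2) : killing M i c3 = N i 1.
Proof.
have -> : c3 = rshift 2 (1 : 'I_2) by exact: val_inj.
exact: row_mxEr.
Qed.

Lemma quad_killing_gram : killing_gram quad_orthotoric M b quad_gram.
Proof.
move=> p mu hp e; have [_ _ D0] := odom_gt0 hp; have [_ _ D1] := odom_neq0 hp.
have yx : p 0 c1 < p 0 c0 by rewrite -subr_gt0.
apply/matrixP => i j; rewrite /quad_gram mxE (eval_gram _ _ yx e).
have K0 := killing0; have K2 := killing2; have K3 := killing3.
have GE := omet_expr quad_orthotoric p.
move: (killing M) (omet _ p) K0 K2 K3 GE => K G K0 K2 K3 GE.
rewrite !mxE sum_ord4 !mxE !sum_ord4 !K2 !K3 !K0 // !GE /entry4 /= !mulN1r !mxE.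
by move: (parabola alpha x1 x2 _) (parabola beta y1 y2 _) => A B;
  rewrite !mul0r !mulr0 !add0r; field; rewrite ?D1.
Qed.

(** The condition on d(H(dL, dL)) is quadratic in L on one side and linear on the other, which fixes
    the scale: 2 / |B'(y_j)| and 2 / |A'(x_i)|. *)
Definition label_scale (j : 'I_4) : R :=
  let ky := 2 / (beta * (y2 - y1)) in let kx := 2 / (alpha * (x2 - x1)) in
  nth kx [:: ky; ky; kx; kx] j.

Definition quad_label : label R :=
  fun j => ascale (label_scale j) (tangent_label y1 y2 x1 x2 M b j).

Lemma label_scale_gt0 j : 0 < label_scale j.
Proof.
have [y12 y2x1 x12] := order.
by elim/ord4_ind: j; rewrite /label_scale /= divr_gt0 // mulr_gt0 // subr_gt0.
Qed.

Lemma quad_labelP : is_label Delta quad_label.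
Proof. exact: is_label_ascale label_scale_gt0 _ HL. Qed.

Lemma tangent_normal s :
  (tangent s M b).1 *m N = \row_(i < 2) [:: - s; 1]`_i.
Proof. by rewrite /= -mulmxA -trmx_mul mulVmx // trmx1 mulmx1. Qed.

Lemma partial_roots i x y mu : y < x -> mu *m M + b = omoment x y ->
  [/\ eval (dexpr i x_expr) mu = (x * M i 0 - M i 1) / (x - y),
      eval (dexpr i y_expr) mu = (M i 1 - y * M i 0) / (x - y) &
      eval (dexpr i gap_expr) mu = ((x + y) * M i 0 - 2 * M i 1) / (x - y)].
Proof.
move=> yx e; have [_ gE _ _] := eval_roots yx e.
have D0 : x - y != 0 by rewrite subr_eq0 gt_eqF.
have mE : eval (moment_expr 0) mu = x + y by rewrite eval_moment e omoment0.
have dm j : eval (dexpr i (moment_expr j)) mu = M i j.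
  by elim/ord2_ind: i => /=; ring.
have dg : eval (dexpr i gap_expr) mu = ((x + y) * M i 0 - 2 * M i 1) / (x - y).
  change ((eval (dexpr i (moment_expr 0)) mu * eval (moment_expr 0) mu
    + eval (moment_expr 0) mu * eval (dexpr i (moment_expr 0)) mu
    + (0 * (4 * eval (moment_expr 1) mu) + -1 * (0 * eval (moment_expr 1) mu
    + 4 * eval (dexpr i (moment_expr 1)) mu))) / (2 * eval gap_expr mu)
    = ((x + y) * M i 0 - 2 * M i 1) / (x - y)).
  by rewrite !dm mE gE; field.
split => //.
- change (0 * (eval (moment_expr 0) mu + eval gap_expr mu)
    + 2^-1 * (eval (dexpr i (moment_expr 0)) mu + eval (dexpr i gap_expr) mu)
    = (x * M i 0 - M i 1) / (x - y)).
  by rewrite dm dg; field.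
- change (0 * (eval (moment_expr 0) mu + -1 * eval gap_expr mu)
    + 2^-1 * (eval (dexpr i (moment_expr 0)) mu +
        (0 * eval gap_expr mu + -1 * eval (dexpr i gap_expr) mu))
    = (M i 1 - y * M i 0) / (x - y)).
  by rewrite dm dg; field.
Qed.

Lemma eval_dgram i (u : 'rV[R]_2) x y mu : y < x -> mu *m M + b = omoment x y ->
  let D := x - y in
  let dx := (x * M i 0 - M i 1) / D in let dy := (M i 1 - y * M i 0) / D in
  let A := parabola alpha x1 x2 x in let B := parabola beta y1 y2 y in
  let uy := u 0 0 + u 0 1 * y in let ux := u 0 0 + u 0 1 * x in
  eval (dexpr i (gram_expr u u)) mu =
  (alpha * (x1 + x2 - 2 * x) * dx * uy ^+ 2 + 2 * A * uy * u 0 1 * dy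
   + beta * (y1 + y2 - 2 * y) * dy * ux ^+ 2 + 2 * B * ux * u 0 1 * dx) / D
  - (A * uy ^+ 2 + B * ux ^+ 2) * (dx - dy) / D ^+ 2.
Proof.
move=> yx e D dx dy A B uy ux; rewrite /ux /uy /B /A /dy /dx /D {D dx dy A B uy ux}.
have [_ gE xE yE] := eval_roots yx e.
have [dxE dyE dgE] := partial_roots i yx e.
have D0 : x - y != 0 by rewrite subr_eq0 gt_eqF.
rewrite /gram_expr /A_expr /B_expr /parabola_expr /EDiv /ESub.
move: xE yE gE dxE dyE dgE; move: x_expr y_expr gap_expr => xe ye ge /=.
move=> -> -> -> -> -> ->; rewrite /parabola.
move: (u 0 0) (u 0 1) (M i 0) (M i 1) => u0 u1 m0 m1.
by field; rewrite ?D0.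
Qed.

Lemma face_roots j mu : face Delta (quad_label j) mu -> exists x y,
  [/\ y < x, mu *m M + b = omoment x y &
      nth False [:: y = y1; y = y2; x = x1; x = x2] j].
Proof.
move=> [Dmu /=]; have [x [y [/andP[xl xr] /andP[yl yr] e]]] := Delta_roots Dmu.
have [y12 y2x1 x12] := order.
rewrite aeval_ascale => /eqP; rewrite mulf_eq0 gt_eqF ?label_scale_gt0 //= => a0.
exists x, y; split => //; first lra.
move: a0; elim/ord4_ind: j; rewrite /tangent_label /lab4 /= ?aeval_ascale
  (aeval_tangent_omoment _ e) ?mulN1r ?oppr_eq0 mulf_eq0 !subr_eq0 => /orP[] /eqP h;
  lra.
Qed.

(** Absorbing the signs of [tangent_label] into k leaves two cases, k B'(s) = 2 and k A'(s) = -2.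
    The zeros only pad the list at the y-sides. *)
Lemma quad_label_normal j : exists s k,
  quad_label j = ascale k (tangent s M b) /\
  [\/ s = nth 0 [:: y1; y2] j /\ k * (beta * (y1 + y2 - 2 * s)) = 2 /\ (j < 2)%N |
      s = nth 0 [:: 0; 0; x1; x2] j /\ k * (alpha * (x1 + x2 - 2 * s)) = -2
        /\ (2 <= j)%N].
Proof.
have [y12 y2x1 x12] := order.
have a0 : alpha != 0 by rewrite gt_eqF.
have b0 : beta != 0 by rewrite gt_eqF.
have x0 : x2 - x1 != 0 by rewrite subr_eq0 gt_eqF.
have y0 : y2 - y1 != 0 by rewrite subr_eq0 gt_eqF.
have kN i l : quad_label i = ascale (label_scale i) (ascale (-1) l) ->
    quad_label i = ascale (- label_scale i) l by move->; rewrite ascaleA mulrN1.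
elim/ord4_ind: j.
- exists y1, (label_scale c0); split; first by [].
  by left; split => //; split => //; rewrite /label_scale /=; field; rewrite ?b0 ?y0.
- exists y2, (- label_scale c1); split; first exact: kN.
  by left; split => //; split => //; rewrite /label_scale /=; field; rewrite ?b0 ?y0.
- exists x1, (- label_scale c2); split; first exact: kN.
  by right; split => //; split => //; rewrite /label_scale /=; field; rewrite ?a0 ?x0.
- exists x2, (label_scale c3); split; first by [].
  by right; split => //; split => //; rewrite /label_scale /=; field; rewrite ?a0 ?x0.
Qed.

Lemma ascale_normal k s : (ascale k (tangent s M b)).1 *m N =
  \row_(i < 2) [:: - k * s; k]`_i.
Proof.
rewrite /ascale [X in X *m _]/= -scalemxAl tangent_normal.
by apply: row2P; rewrite !mxE /=; ring.
Qed.

(** On a side y = s the normal corresponds to a multiple of the covector (-s, 1), which kills the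
    A-term, while B vanishes. To first order along the normal only B'(s) survives, whence the scale.
    The sides x = s are symmetric. *)
Lemma face_gram j mu : face Delta (quad_label j) mu ->
  (forall v, bil (quad_gram mu) (quad_label j).1 v = 0) /\
  (forall i, partial i (fun nu => bil (quad_gram nu) (quad_label j).1
     (quad_label j).1) mu = 2 * (quad_label j).1 0 i).
Proof.
move=> Fmu; have [x [y [yx e rt]]] := face_roots Fmu.
have D0 : x - y != 0 by rewrite subr_eq0 gt_eqF.
have [dpos _ _ _] := eval_roots yx e.
have [s [k [LE sk]]] := quad_label_normal j.
have vanish : (y = s /\ parabola beta y1 y2 y = 0 /\
     k * (beta * (y1 + y2 - 2 * y)) = 2) \/
   (x = s /\ parabola alpha x1 x2 x = 0 /\
     k * (alpha * (x1 + x2 - 2 * x)) = -2).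
  by move: rt sk {Fmu LE}; elim/ord4_ind: j => /= -> [[-> [kE //]]|[-> [kE //]]] _;
    [left|left|right|right]; (split; first by []); split => //; rewrite /parabola; ring.
split.
  move=> v; rewrite bil_quad_gram LE ascale_normal (eval_gram _ _ yx e) !mxE /=.
  by case: vanish => -[<- [-> _]]; field; rewrite ?D0.
move=> i; rewrite LE.
have -> : partial i (fun nu => bil (quad_gram nu) (ascale k (tangent s M b)).1
    (ascale k (tangent s M b)).1) mu =
    eval (dexpr i (gram_expr (\row_(i < 2) [:: - k * s; k]`_i)
                             (\row_(i < 2) [:: - k * s; k]`_i))) mu.
  apply: (partial_eval_on _ open_disc_pos) => //; last exact: regular_gram.
  by move=> nu _; rewrite bil_quad_gram ascale_normal.
rewrite (eval_dgram _ _ yx e) [in RHS]mxE tangent1E !mxE /=.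
case: vanish => -[<- [-> kE]].
  transitivity (k * (k * (beta * (y1 + y2 - 2 * y))) * (M i 1 - y * M i 0)).
    by field; rewrite ?D0.
  by rewrite kE; ring.
transitivity (k * (k * (alpha * (x1 + x2 - 2 * x))) * (x * M i 0 - M i 1)).
  by field; rewrite ?D0.
by rewrite kE; ring.
Qed.

Lemma parabola_ge0 (k r1 r2 x : R) : 0 <= k -> r1 <= x <= r2 ->
  0 <= parabola k r1 r2 x.
Proof. by move=> k0 /andP[? ?]; rewrite /parabola !mulr_ge0 // subr_ge0. Qed.

Lemma parabola_eq0 (k r1 r2 x : R) : 0 < k -> parabola k r1 r2 x = 0 ->
  x = r1 \/ x = r2.
Proof.
move=> k0 /eqP; rewrite /parabola !mulf_eq0 gt_eqF //= !subr_eq0.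
by move=> /orP[] /eqP; [left|right].
Qed.

(** If H(v, v) is not positive, then A wy^2 = B wx^2 = 0. Where wy is nonzero, A vanishes and x is
    x1 or x2, so the tangent at x is a side through mu; likewise for wx and y. *)
Lemma quad_gram_pos mu v : Delta mu ->
  ~~ (v <= \matrix_(j < 4)
         (if aeval (quad_label j) mu == 0 then (quad_label j).1 else 0))%MS ->
  0 < bil (quad_gram mu) v v.
Proof.
move=> Dmu; apply: contraNT; rewrite -leNgt bil_quad_gram.
have [x [y [xr yr e]]] := Delta_roots Dmu.
have yx : y < x.
  by have [? ? ?] := order; move: xr yr => /andP[? _] /andP[_ ?]; lra.
have D0 : 0 < x - y by rewrite subr_gt0.
have D1 : x - y != 0 by rewrite gt_eqF.
rewrite (eval_gram _ _ yx e); set w := v *m N.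
rewrite pmulr_lle0 ?invr_gt0 // -!expr2.
have A0 := parabola_ge0 (ltW alpha0) xr; have B0 := parabola_ge0 (ltW beta0) yr.
set A := parabola alpha x1 x2 x in A0 *; set B := parabola beta y1 y2 y in B0 *.
set wy := w 0 0 + w 0 1 * y; set wx := w 0 0 + w 0 1 * x => le0.
have Ay := mulr_ge0 A0 (sqr_ge0 wy); have Bx := mulr_ge0 B0 (sqr_ge0 wx).
have Ay0 : A * wy ^+ 2 = 0 by lra.
have Bx0 : B * wx ^+ 2 = 0 by lra.
set S := \matrix_(j < 4) _.
have inS s j k : quad_label j = ascale k (tangent s M b) -> k != 0 ->
    (s - x) * (s - y) = 0 -> ((tangent s M b).1 <= S)%MS.
  move=> LE k0 s0; have := row_sub j S; rewrite rowK LE aeval_ascale.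
  rewrite (aeval_tangent_omoment _ e) s0 mulr0 eqxx /=.
  by rewrite eqmx_scale.
have lab s : [\/ s = y1, s = y2, s = x1 | s = x2] ->
    exists j k, k != 0 /\ quad_label j = ascale k (tangent s M b).
  case=> ->.
  - by exists c0, (label_scale c0); rewrite gt_eqF // label_scale_gt0.
  - exists c1, (- label_scale c1); rewrite oppr_eq0 gt_eqF ?label_scale_gt0 //.
    by rewrite -mulrN1 -ascaleA.
  - exists c2, (- label_scale c2); rewrite oppr_eq0 gt_eqF ?label_scale_gt0 //.
    by rewrite -mulrN1 -ascaleA.
  - by exists c3, (label_scale c3); rewrite gt_eqF // label_scale_gt0.
have inSx : (((- wy / (x - y)) *: (tangent x M b).1) <= S)%MS.
  move/eqP: Ay0; rewrite mulf_eq0 sqrf_eq0 => /orP[/eqP/(parabola_eq0 alpha0) xE|/eqP ->].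
    have [j [k [k0 LE]]] : exists j k, k != 0 /\ quad_label j = ascale k (tangent x M b).
      by apply: lab; case: xE => ->; [apply: Or43|apply: Or44].
    by apply/scalemx_sub/(inS _ _ _ LE k0); ring.
  by rewrite oppr0 mul0r scale0r sub0mx.
have inSy : (((wx / (x - y)) *: (tangent y M b).1) <= S)%MS.
  move/eqP: Bx0; rewrite mulf_eq0 sqrf_eq0 => /orP[/eqP/(parabola_eq0 beta0) yE|/eqP ->].
    have [j [k [k0 LE]]] : exists j k, k != 0 /\ quad_label j = ascale k (tangent y M b).
      by apply: lab; case: yE => ->; [apply: Or41|apply: Or42].
    by apply/scalemx_sub/(inS _ _ _ LE k0); ring.
  by rewrite mul0r scale0r sub0mx.
(* Linear interpolation: w_0 + w_1 s is determined by its values wx and wy at s = x and s = y. *)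
suff -> : v = (- wy / (x - y)) *: (tangent x M b).1 + (wx / (x - y)) *: (tangent y M b).1.
  exact: addmx_sub.
have uN : N \in unitmx by rewrite unitmx_tr unitmx_inv.
apply: (can_inj (mulmxK uN)); rewrite mulmxDl -!scalemxAl !tangent_normal -/w.
by rewrite /wx /wy; move: (w) => w'; apply: row2P; rewrite !mxE /=; field.
Qed.

Lemma quad_abreu_guillemin : abreu_guillemin Delta quad_label quad_gram.
Proof.
(* The closed formula is its own smooth extension across the sides. *)
exists disc_pos, quad_gram; split.
- split.
  + exact: open_disc_pos.
  + move=> mu Dmu; have [x [y [xr yr e]]] := Delta_roots Dmu.
    have yx : y < x.
      by have [? ? ?] := order; move: xr yr => /andP[? _] /andP[_ ?]; lra.
    by have [] := eval_roots yx e.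
  + move=> i j; apply: (smooth_on_eval open_disc_pos
      (e := gram_expr (row i N) (row j N))).
      by move=> mu _; rewrite mxE.
    by move=> mu; exact: regular_gram.
  + by [].
- by move=> mu j; exact: face_gram.
- by move=> mu v; exact: quad_gram_pos.
Qed.

End Boundary.

End QuadraticMetric.

(** * The two-parameter family *)

Section FluxRoots.
Variables (R : realType) (y1 y2 x1 x2 : R).
Hypothesis order : [/\ y1 < y2, y2 < x1 & x1 < x2].

(** The coefficient of alpha beta in [flux_sq]; those of alpha^2 and beta^2 are -(x2 - x1)^2 / 4 and
    -(y2 - y1)^2 / 4. Then [flux_disc] is the discriminant of the form, and [flux_root] at -1 and 1
    gives its zeros in alpha / beta. *)
Definition flux_lin : R := x1 * x2 + y1 * y2 - (x1 + x2) * (y1 + y2) / 2.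

Definition flux_disc : R :=
  flux_lin ^+ 2 - ((x2 - x1) * (y2 - y1)) ^+ 2 / 4.

Definition flux_root (e : R) : R :=
  2 * (flux_lin + e * Num.sqrt flux_disc) / (x2 - x1) ^+ 2.

(** The difference of the last two terms is (x1 - y2)(x2 - y1): this is where y2 < x1 enters. *)
Lemma flux_lin_gt0 : 0 < (x2 - x1) * (y2 - y1) / 2 < flux_lin.
Proof.
have [y12 y2x1 x12] := order; apply/andP; split.
  by rewrite divr_gt0 // mulr_gt0 // subr_gt0.
rewrite -subr_gt0.
have -> : flux_lin - (x2 - x1) * (y2 - y1) / 2 = (x1 - y2) * (x2 - y1).
  by rewrite /flux_lin; field.
by rewrite mulr_gt0 // subr_gt0; lra.
Qed.

Lemma flux_disc_gt0 : 0 < flux_disc.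
Proof.
have /andP[h0 hK] := flux_lin_gt0.
have -> : flux_disc = (flux_lin - (x2 - x1) * (y2 - y1) / 2)
    * (flux_lin + (x2 - x1) * (y2 - y1) / 2) by rewrite /flux_disc; field.
by rewrite mulr_gt0 //; lra.
Qed.

Lemma flux_root_lt : 0 < flux_root (-1) < flux_root 1.
Proof.
have /andP[h0 hK] := flux_lin_gt0; have d0 := flux_disc_gt0.
have [_ _ x12] := order; have w0 : 0 < x2 - x1 by rewrite subr_gt0.
have s0 : 0 < Num.sqrt flux_disc by rewrite sqrtr_gt0.
have sK : Num.sqrt flux_disc < flux_lin.
  have K0 : 0 < flux_lin by lra.
  rewrite -(ger0_norm (ltW K0)) -sqrtr_sqr ltr_sqrt ?exprn_gt0 //.
  rewrite /flux_disc ltrBlDr ltrDl divr_gt0 // exprn_gt0 //; lra.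
rewrite /flux_root mulN1r mul1r; apply/andP; split.
  by rewrite divr_gt0 ?exprn_gt0 // mulr_gt0 // subr_gt0.
by rewrite ltr_pM2r ?invr_gt0 ?exprn_gt0 // ltr_pM2l //; lra.
Qed.

Lemma flux_sq_factor (alpha beta : R) : beta != 0 ->
  flux_sq y1 y2 x1 x2 alpha beta = beta ^+ 2 * ((x2 - x1) ^+ 2 / 4) *
    ((alpha / beta - flux_root (-1)) * (flux_root 1 - alpha / beta)).
Proof.
move=> b0; have [_ _ x12] := order.
have w0 : x2 - x1 != 0 by rewrite subr_eq0 gt_eqF.
have sE := sqr_sqrtr (ltW flux_disc_gt0).
rewrite /flux_root; set s := Num.sqrt _ in sE *.
transitivity (((x2 - x1) ^+ 2 / 4) * (- alpha ^+ 2
  + alpha * beta * (4 * flux_lin / (x2 - x1) ^+ 2)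
  - beta ^+ 2 * 4 * (flux_lin ^+ 2 - s ^+ 2) / (x2 - x1) ^+ 4)).
  by rewrite sE /flux_disc /flux_sq /flux_lin; field.
by field; rewrite ?b0 ?w0.
Qed.

End FluxRoots.

Lemma continuous_ascale (R : realType) (l : affine_fun R) :
  continuous (fun k : R => ascale k l).
Proof.
move=> k; have h1 : (fun k : R => k *: l.1) x @[x --> k] --> k *: l.1.
  exact: scalel_continuous.
have h2 : (fun k : R => k * l.2) x @[x --> k] --> k * l.2.
  by apply: cvgM; [exact: cvg_id|exact: cvg_cst].
exact: (cvg_pair h1 h2).
Qed.

(** * Labels parametrised by the leading coefficients of the profiles *)

Section Family.
Variables (R : realType) (y1 y2 x1 x2 : R) (M : 'M[R]_2) (b : 'rV[R]_2).
Hypothesis order : [/\ y1 < y2, y2 < x1 & x1 < x2].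
Hypothesis uM : M \in unitmx.

(** The interval is closed, so that both ratios with theta = 0 belong to the family. *)
Definition ratios : set R :=
  [set r | flux_root y1 y2 x1 x2 (-1) <= r <= flux_root y1 y2 x1 x2 1].

Definition label_family (t : R * R) : label R :=
  quad_label y1 y2 x1 x2 t.1 t.2 M b.

(** The scale of an x-side recovers t_1 and that of a y-side t_2; a scale is read off at a vertex
    not on the side. *)
Lemma label_family_inj t u : params ratios t -> params ratios u ->
  label_family t = label_family u -> t = u.
Proof.
case: t u => [t1 t2] [u1 u2] [/= t10 t20 _] [/= u10 u20 _] e.
have [y12 y2x1 x12] := order.
have key j x y : aeval (tangent_label y1 y2 x1 x2 M b j)
    ((omoment x y - b) *m invmx M) != 0 ->
    label_scale y1 y2 x1 x2 t1 t2 j = label_scale y1 y2 x1 x2 u1 u2 j.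
  move=> n0; have /(congr1 (fun l => aeval (l j) ((omoment x y - b) *m invmx M))) := e.
  by rewrite /label_family /quad_label !aeval_ascale => /(mulIf n0).
have mE x y : (omoment x y - b) *m invmx M *m M + b = omoment x y.
  by rewrite mulmxKV // subrK.
have inj (t v w : R) : 0 < t -> 0 < v -> 0 < w -> 2 / (t * w) = 2 / (v * w) -> t = v.
  move=> t0 v0 w0 /(mulfI _); rewrite pnatr_eq0 => /(_ isT)/invr_inj.
  by move/(mulIf (lt0r_neq0 w0)).
have e1 : t1 = u1.
  apply: (inj _ _ (x2 - x1)) => //; first by rewrite subr_gt0.
  (* The vertex with roots x1, y1 lies off the side x = x2. *)
  apply: (key c3 x1 y1); rewrite /tangent_label /lab4 /=.
  by rewrite (aeval_tangent_omoment _ (mE _ _)) mulf_neq0 // subr_eq0 gt_eqF //; lra.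
have e2 : t2 = u2.
  apply: (inj _ _ (y2 - y1)) => //; first by rewrite subr_gt0.
  apply: (key c0 x1 y2); rewrite /tangent_label /lab4 /=.
  by rewrite (aeval_tangent_omoment _ (mE _ _)) mulf_neq0 // subr_eq0 lt_eqF //; lra.
by rewrite e1 e2.
Qed.

Lemma label_family_continuous j :
  {within params ratios, continuous (fun t => label_family t j)}.
Proof.
have [y12 y2x1 x12] := order.
apply: continuous_in_subspaceT => t; rewrite inE => -[t10 t20 _].
apply: (@continuous_comp _ _ _ (fun t : R * R => label_scale y1 y2 x1 x2 t.1 t.2 j)
  (fun k => ascale k (tangent_label y1 y2 x1 x2 M b j))); last exact: continuous_ascale.
have cV (f : R * R -> R) (w : R) : f @ t --> f t -> 0 < f t -> 0 < w ->
    (fun t => 2 / (f t * w)) @ t --> 2 / (f t * w).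
  move=> cf f0 w0; apply: cvgM; first exact: cvg_cst.
  apply: cvgV; first by rewrite mulf_neq0 // gt_eqF.
  by apply: cvgM => //; exact: cvg_cst.
have c1 : (fun t : R * R => t.1) @ t --> t.1 by exact: cvg_fst.
have c2 : (fun t : R * R => t.2) @ t --> t.2 by exact: cvg_snd.
by elim/ord4_ind: j; rewrite /label_scale /=; apply: cV; rewrite // subr_gt0.
Qed.

Lemma label_family_two_parameter : two_parameter_family ratios label_family.
Proof.
have /andP[r0 r12] := flux_root_lt order.
split.
- move=> r s /andP[? ?] /andP[? ?] z /andP[? ?]; apply/andP; split; lra.
- exists (flux_root y1 y2 x1 x2 (-1)), (flux_root y1 y2 x1 x2 1).
  by split => //; rewrite /ratios /= lexx ltW.
- by move=> t u; exact: label_family_inj.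
- exact: label_family_continuous.
Qed.

End Family.

Theorem proposition9p1 (R : realType) (Delta : set 'rV[R]_2)
    (quadD : convex_quadrilateral Delta)
    (nparD : forall F G : set 'rV[R]_2, is_facet Delta F -> is_facet Delta G ->
       F <> G -> ~ parallel F G) :
  exists (I : set R) (L : R * R -> label R) (r1 r2 : R),
    [/\ two_parameter_family I L,
        [/\ I r1, I r2, 0 < r1, 0 < r2 & r1 <> r2] &
        forall t : R * R, params I t ->
          is_label Delta (L t) /\
          exists (O : orthotoric R) (M : 'M[R]_2) (b : 'rV[R]_2)
                 (H : 'rV[R]_2 -> 'M[R]_2),
            [/\ affine_identification Delta O M b,
                killing_gram O M b H,
                abreu_guillemin Delta (L t) H,
                forall p, odom O p -> 0 < scalar_curvature (omet O) p &
                (exists theta : 'rV[R]_4 -> 'M[R]_4,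
                   closed_primitive_11 O theta /\ curvature_equation O theta) /\
                (t.1 / t.2 = r1 \/ t.1 / t.2 = r2 ->
                   curvature_equation O (fun=> 0))]].
Proof.
have [y1 [y2 [x1 [x2 [M [b [order uM HL]]]]]]] :=
  quadrilateral_normal_form quadD nparD.
have /andP[r0 r12] := flux_root_lt order.
exists (ratios y1 y2 x1 x2), (label_family y1 y2 x1 x2 M b).
exists (flux_root y1 y2 x1 x2 (-1)), (flux_root y1 y2 x1 x2 1); split.
- exact: label_family_two_parameter.
- split => //; rewrite /ratios /= ?lexx ?ltW //; first exact: lt_trans r0 r12.
  by move=> e; move: r12; rewrite e ltxx.
- move=> [alpha beta] [/= alpha0 beta0 /andP[rl ru]].
  have b0 : beta != 0 by rewrite gt_eqF.
  have fE := flux_sq_factor order alpha b0.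
  split; first exact: quad_labelP.
  exists (quad_orthotoric order alpha0 beta0), M, b,
    (quad_gram y1 y2 x1 x2 alpha beta M b); split.
  + exact: quad_affine_identification.
  + exact: quad_killing_gram.
  + exact: quad_abreu_guillemin.
  + exact: quad_scalar_curvature_gt0.
  + split.
      apply: quad_curvature_equation_flux; rewrite fE.
      apply: mulr_ge0; last by rewrite mulr_ge0 // subr_ge0.
      by rewrite mulr_ge0 ?sqr_ge0 // divr_ge0 ?sqr_ge0.
    move=> re; apply: quad_curvature_equation0; rewrite fE.
    by case: re => ->; rewrite subrr ?mul0r ?mulr0.
Qed.
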